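(* There is an absolute constant $n_0$ such that the following holds. Let $G$ be any $d$-regular graph on $n\ge n_0$ vertices, and let $\gamma$ be the spectral gap of the simple random walk on $G$. Then for any $0 \leq \varepsilon \leq \gamma/128$, \[ t_{\mathsf{cov}}^{\varepsilon\mathsf{TB}}(G) \leq 10^{10} \cdot d^{100/\gamma}\cdot n \cdot \min\{\varepsilon^{-1}, \; \log n \}. \]
   Context: All graphs are finite, simple, undirected and connected; $\log$ is the natural logarithm. By convention $0^{-1}=\infty$ and $\min\{\infty,x\}=x$. The simple random walk on $G$ moves in each step to a uniformly random neighbour; its spectral gap is $\gamma=1-\lambda_2$, where $\lambda_2$ is the second largest eigenvalue of its transition matrix. The $\varepsilon$-time-biased random walk ($\varepsilon$-TBRW), $\varepsilon\in[0,1]$, is the following process $(X_t)_{t\ge0}$ on $V(G)$: in each step, independently, with probability $1-\varepsilon$ the walk moves to a uniformly random neighbour of the current vertex, and with probability $\varepsilon$ it moves to a neighbour sampled from a probability distribution on the neighbours chosen by a controller; this distribution may depend on the whole history $X_0,\dots,X_t$. I.e. the step at time $t$ uses the transition matrix $(1-\varepsilon)P+\varepsilon B_t$, where $P$ is the simple random walk matrix and $B_t$ is a stochastic matrix supported on $E(G)$ which may depend on the history. A strategy is a rule specifying these choices. $C_v^{\varepsilon\mathsf{TB}}(G)$ is the expected time for the $\varepsilon$-TBRW to visit every vertex of $G$ when started from $v$, minimized over all strategies, and $t_{\mathsf{cov}}^{\varepsilon\mathsf{TB}}(G)=\max_{v\in V}C_v^{\varepsilon\mathsf{TB}}(G)$.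 *)

(* Defs.v *)
From HB Require Import structures.
From mathcomp Require Import all_boot all_order all_algebra.
From mathcomp Require Import all_classical all_reals all_analysis.

Set Implicit Arguments.
Unset Strict Implicit.
Unset Printing Implicit Defensive.

Import Order.TTheory GRing.Theory Num.Theory.
Local Open Scope classical_set_scope.
Local Open Scope ring_scope.

Definition simple_graph (V : finType) (e : rel V) : Prop :=
  symmetric e /\ irreflexive e.

Definition connected_graph (V : finType) (e : rel V) : Prop :=
  forall x y : V, connect e x y.

Definition degree (V : finType) (e : rel V) (x : V) : nat :=
  #|[pred y | e x y]|.

Definition regular_graph (V : finType) (e : rel V) (d : nat) : Prop :=
  forall x : V, degree e x = d.

Definition srw (R : realType) (V : finType) (e : rel V) (x y : V) : R :=
  if e x y then (degree e x)%:R^-1 else 0.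

Definition srw_mx (R : realType) (V : finType) (e : rel V) : 'M[R]_#|V| :=
  \matrix_(i, j) srw R e (enum_val i) (enum_val j).

(* Eigenvalues listed in nonincreasing order, with algebraic multiplicity.
   This is meaningful when the characteristic polynomial splits over R, as it
   does for the simple random walk on a graph, which is reversible. *)
Definition eigenvalues (R : realType) (n : nat) (A : 'M[R]_n) : seq R :=
  xget [::] [set s : seq R | sorted >=%R s /\
                             char_poly A = \prod_(a <- s) ('X - a%:P)].

Definition spectral_gap (R : realType) (V : finType) (e : rel V) : R :=
  1 - (eigenvalues (srw_mx R e))`_1.

(* [bias h x] is the row at [x] of the controller's matrix B_t when the history
   X_0, ..., X_t is [rcons h x], i.e. X_t = x and t = size h. *)
Record strategy (R : realType) (V : finType) (e : rel V) := Strategy {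
  bias :> seq V -> V -> V -> R ;
  bias_ge0 : forall h x y, 0 <= bias h x y ;
  bias_sum : forall h x, \sum_y bias h x y = 1 ;
  bias_supp : forall h x y, ~~ e x y -> bias h x y = 0 }.

(* The transition rule is the product form of
   P(X_(t+1) = y | (X_0, ..., X_t) = rcons h x) =
     (1 - eps) * srw x y + eps * b h x y,   with t = size h. *)
Definition is_tbrw (R : realType) (V : finType) (e : rel V) (eps : R)
    (b : strategy R e) (v : V) (disp : measure_display)
    (Omega : measurableType disp) (P : probability Omega R)
    (X : nat -> Omega -> V) : Prop :=
  [/\ forall t y, measurable (X t @^-1` [set y]),
      P (X 0%N @^-1` [set v]) = 1%E &
      forall (h : seq V) (x y : V),
        P [set w | mkseq (X^~ w) (size h).+2 = rcons (rcons h x) y] =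
        (P [set w | mkseq (X^~ w) (size h).+1 = rcons h x] *
         ((1 - eps) * srw R e x y + eps * b h x y)%:E)%E].

(* First time at which all vertices have been visited, +oo if there is none. *)
Definition cover_time (R : realType) (V : finType) (X : nat -> V) : \bar R :=
  ereal_inf [set (t%:R)%:E | t in
    [set t : nat | forall y : V, exists2 s : nat, (s <= t)%N & X s = y]].

(* The expectation depends only on the law of the walk, hence only on [b] (and
   [v], [eps]); ranging also over all realizations of the walk on probability
   spaces thus amounts to taking the infimum over strategies. *)
Definition tb_cover_from (R : realType) (V : finType) (e : rel V) (eps : R)
    (v : V) : \bar R :=
  ereal_inf [set c | exists (b : strategy R e) (disp : measure_display)
      (Omega : measurableType disp) (P : probability Omega R)
      (X : nat -> Omega -> V),
    is_tbrw eps b v P X /\ c = (\int[P]_w cover_time R (X^~ w))%E].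

Definition tb_cover (R : realType) (V : finType) (e : rel V) (eps : R)
    : \bar R :=
  \big[maxe/-oo%E]_(v : V) tb_cover_from e eps v.

(* Main.v *)
Require Import Defs.
From HB Require Import structures.
From mathcomp Require Import all_boot all_order all_algebra.
From mathcomp Require spectral sesquilinear complex.
From mathcomp Require Import all_classical all_reals all_analysis.
From mathcomp Require Import measurable_realfun.
From mathcomp Require Import ring lra.

(** Write [s = m / n] for the density of the [m] vertices that remain to be
    visited.  An unbiased walk finds a new vertex at rate about [s], which sums
    to [n * ln n].  A controller with bias [eta] can raise a small probability
    or expectation [a] of the unbiased walk to [a `^ (1 - eta)]: by backward
    induction this is the one-step inequality [powR_avg_le], an instance of
    [t `^ (1 - eta) <= (1 - eta) * t + eta].  With new vertices found at rate
    about [s `^ (1 - eta / 2)], the sum over [m] of [(n / m) `^ (1 - eta / 2)] is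
    at most [2 * n / eta] and still at most [n * (1 + ln n)]
    ([powR_sum_le_inv], [powR_sum_le_ln]).  The generous factor
    [d `^ (100 / gamma)] allows the choice [eta = eps / d]; then the density of the
    biased walk with respect to the lazy walk grows by a factor at most
    [1 + 2 * eps] per step, with [2 * eps <= gamma / 64], and the spectral gap
    dominates this growth.

    The difficulty is the cost of order [ln n] of mixing from an arbitrary
    vertex, which is affordable neither for each new vertex nor, while [s] is
    above [1 / ln n], for each attempt.  One round therefore mixes once, for
    [O(ln n / gamma)] steps, and then explores for about as long in many
    blocks of length [O(ln (1 / s) / gamma)]: unbiased steps which restore
    uniformity in mean square, then a biased window ([exploration_round],
    [visits_blocks]).  During the round the strategy aims at the set [U] of
    vertices unvisited at its start.  Expected visits to [U] are converted into
    new vertices by [round_bound], since a vertex is revisited only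
    [O(1 / gamma)] times in expectation during a round ([returns_le]).

    The optimal cost is handled through the optimality equation.  The
    finite-horizon optimal costs are subsolutions ([value_subsolution]); every
    subsolution is bounded, at states with [m] unvisited vertices, by
    [budget m], the sum of the costs of visiting the vertices one by one
    ([subsolution_le_budget]), because at a state of largest excess one round
    would give a contradiction ([maximum_principle]).  Standing still costs
    nothing in this comparison, so the lazy walk may be used throughout,
    and negative eigenvalues do not matter; the lazy walk contracts functions of
    mean zero by the factor [1 - gamma / 2] ([spectral_gap_contraction]).

    Finally the limit of the finite-horizon costs defines a greedy strategy, a
    random walk following it is built on the unit interval with the uniform
    probability ([exists_tbrw]), and its expected cover time, the sum of the
    probabilities of not having covered the graph at a given time, is at most
    the optimal cost ([expected_cover_le]). *)

Import Order.TTheory GRing.Theory Num.Theory.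
Local Open Scope ring_scope.

Set Implicit Arguments.
Unset Strict Implicit.
Unset Printing Implicit Defensive.

(** * Spectral theorem for real symmetric matrices *)

Section SpectralTheorem.
Import spectral sesquilinear complex.

(** The unitary diagonalisation over [R[i]], read off in real and imaginary
    parts: row [i] of the unitary matrix has entries [g i k + i h i k], and the
    last clause is Parseval's identity for a real vector [f].  Working with
    these pairs spares the construction of a real orthonormal eigenbasis. *)
Lemma symmetric_spectral (R : realType) (n : nat) (A : 'M[R]_n) :
  (forall k l, A k l = A l k) ->
  exists (D : 'I_n -> R) (g h : 'I_n -> 'I_n -> R),
  [/\ char_poly A = \prod_i ('X - (D i)%:P),
      (forall i k, \sum_l A k l * g i l = D i * g i k) /\
      (forall i k, \sum_l A k l * h i l = D i * h i k),
      forall i j, \sum_k (g i k * g j k + h i k * h j k) = (i == j)%:R &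
      forall f : 'I_n -> R,
        \sum_i ((\sum_k g i k * f k) ^+ 2 + (\sum_k h i k * f k) ^+ 2) =
        \sum_k f k ^+ 2].
Proof.
move=> Asym.
pose toC := real_complex R.
pose B : 'M[R[i]]_n := map_mx toC A.
have BE k l : B k l = (A k l)%:C%C by rewrite mxE.
have Breal : B \is a mxOver Num.real.
  by apply/mxOverP => k l; rewrite BE; apply/complex_realP; exists (A k l).
have Bherm : B \is hermsymmx.
  apply: realsym_hermsym => //; apply/is_hermitianmxP.
  rewrite expr0 scale1r; apply/matrixP => k l.
  by rewrite !mxE Asym.
pose U : 'M[R[i]]_n := spectralmx B; pose sp : 'rV[R[i]]_n := spectral_diag B.
have HU : U \is unitarymx by exact: spectral_unitarymx.
pose re : R[i]%C -> R := @complex.Re R; pose im : R[i]%C -> R := @complex.Im R.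
have reS (F : 'I_n -> R[i]%C) : re (\sum_k F k) = \sum_k re (F k).
  by apply: (big_morph re) => // -[? ?] [? ?].
have imS (F : 'I_n -> R[i]%C) : im (\sum_k F k) = \sum_k im (F k).
  by apply: (big_morph im) => // -[? ?] [? ?].
have spreal : forall i, toC (re (sp 0 i)) = sp 0 i.
  move=> i; apply: RRe_real; have /mxOverP := hermitian_spectral_diag_real Bherm.
  exact.
have BU : B = invmx U *m diag_mx sp *m U.
  by apply/orthomx_spectralP; exact: hermitian_normalmx.
have Uunit : U \in unitmx by exact: unitarymx_unit.
have UB : U *m B = diag_mx sp *m U by rewrite BU !mulmxA mulmxV// mul1mx.
have UE i k : U i k = (re (U i k) +i* im (U i k))%C by case: (U i k).
exists (fun i => re (sp 0 i)), (fun i k => re (U i k)), (fun i k => im (U i k)).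
have eig i k : (\sum_l A k l * re (U i l) = re (sp 0 i) * re (U i k)) /\
               (\sum_l A k l * im (U i l) = re (sp 0 i) * im (U i k)).
  have := congr1 (fun M : 'M[R[i]%C]_n => M i k) UB.
  rewrite mul_diag_mx !mxE -spreal => E.
  have ReE := congr1 re E; have ImE := congr1 im E.
  move: ReE ImE.
  rewrite reS imS.
  move=> ReE ImE; split.
    transitivity (re (toC (re (sp 0 i)) * U i k)); last first.
      by rewrite [U i k]UE /= mul0r subr0.
    rewrite -ReE; apply: eq_bigr => l _.
    by rewrite BE [U i l]UE /= mulr0 subr0 mulrC (Asym k l).
  transitivity (im (toC (re (sp 0 i)) * U i k)); last first.
    by rewrite [U i k]UE /= mul0r addr0.
  rewrite -ImE; apply: eq_bigr => l _.
  by rewrite BE [U i l]UE /= mulr0 add0r mulrC (Asym k l).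
have ReM (a b : R[i]) : re (a * (b^*)%C) = re a * re b + im a * im b.
  by case: a b => [? ?] [? ?] /=; rewrite mulrN opprK.
split.
- apply: (@map_inj_poly _ _ toC) => //; first exact: complexI.
  rewrite map_char_poly rmorph_prod /=.
  have -> : char_poly (map_mx toC A) = char_poly (diag_mx sp).
    rewrite -/B BU /char_poly /char_poly_mx !map_mxM/=.
    set V' := map_mx polyC (invmx U); set U' := map_mx polyC U.
    have VU : V' *m U' = 1%:M by rewrite -map_mxM mulVmx// map_mx1.
    have -> : 'X%:M - V' *m map_mx polyC (diag_mx sp) *m U' =
        V' *m ('X%:M - map_mx polyC (diag_mx sp)) *m U'.
      by rewrite mulmxBr mulmxBl scalar_mxC -!mulmxA VU mulmx1.
    by rewrite !det_mulmx mulrAC -det_mulmx VU det1 mul1r.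
  rewrite char_poly_trig ?diag_mx_is_trig//; apply: eq_bigr => i _.
  rewrite map_polyXsubC/= !mxE eqxx mulr1n.
  by rewrite -{1}spreal.
- by split=> i k; have [] := eig i k.
- move=> i j; have /unitarymxP/(congr1 (fun M : 'M[R[i]%C]_n => M i j)) := HU.
  rewrite !mxE => /(congr1 re).
  rewrite reS => E.
  transitivity (re ((i == j)%:R : R[i])); last by case: eqP.
  rewrite -E; apply: eq_bigr => k _.
  by rewrite !mxE ReM.
- move=> f.
  have Ortho k l : \sum_i (re (U i k) * re (U i l) + im (U i k) * im (U i l)) = (k == l)%:R.
    have := mulVmx Uunit; rewrite invmx_unitary// => /(congr1 (fun M : 'M[R[i]%C]_n => M l k)).
    rewrite !mxE => /(congr1 re).
    rewrite reS => E.
    transitivity (re ((l == k)%:R : R[i])); last by rewrite eq_sym; case: eqP.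
    rewrite -E; apply: eq_bigr => i _.
    by rewrite !mxE [X in _ = re X]mulrC ReM.
  transitivity (\sum_k \sum_l f k * f l * (k == l)%:R); last first.
    apply: eq_bigr => k _; rewrite (bigD1 k)//= eqxx mulr1 big1 ?addr0 ?expr2//.
    by move=> l; rewrite eq_sym => /negbTE ->; rewrite mulr0.
  transitivity (\sum_i \sum_k \sum_l f k * f l * (re (U i k) * re (U i l) + im (U i k) * im (U i l))).
    apply: eq_bigr => i _; rewrite !expr2 !big_distrlr /= -big_split /=.
    apply: eq_bigr => k _; rewrite -big_split /=; apply: eq_bigr => l _; ring.
  rewrite exchange_big /=; apply: eq_bigr => k _.
  rewrite exchange_big /=; apply: eq_bigr => l _.
  by rewrite -mulr_sumr Ortho.
Qed.

End SpectralTheorem.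

(** * Random walk on a regular graph *)

Definition avg (R : realType) (V : finType) (Q : V -> V -> R) (f : V -> R) (x : V) : R :=
  \sum_y Q x y * f y.

Section Graph.
Context (R : realType) (V : finType) (e : rel V) (d : nat).
Hypothesis simple_e : simple_graph e.
Hypothesis conn_e : connected_graph e.
Hypothesis reg_e : regular_graph e d.
Hypothesis card_gt2 : (2 < #|V|)%N.

(** If every degree is at most 1, a vertex and its neighbour form a whole
    component. *)
Lemma degree_gt1 : (1 < d)%N.
Proof.
have [esym eirr] := simple_e.
rewrite ltnNge; apply/negP => dle1.
have /card_gt0P[x _] : (0 < #|V|)%N by exact: leq_trans card_gt2.
pose A := [pred z | (z == x) || e x z].
have closedA : fingraph.closed e A.
  apply: intro_closed; first exact: sym_connect_sym.
  move=> y z eyz; rewrite !inE => /orP[/eqP yx|exy]; first by rewrite -yx eyz orbT.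
  have : (#|[pred w | e y w]| <= 1)%N by rewrite (leq_trans _ dle1)// -(reg_e y).
  move=> /card_le1_eqP/(_ z x); rewrite !inE eyz esym exy => -> //.
  by rewrite eqxx.
have : (#|V| <= 2)%N.
  apply: leq_trans (_ : #|A| <= 2)%N.
    apply/subset_leq_card/fintype.subsetP => z _.
    by rewrite -(closed_connect closedA (conn_e x z)) inE eqxx.
  have -> : #|A| = #|[predU1 x & [pred z | e x z]]| by apply: eq_card.
  by rewrite cardU1 -[2%N]/(1 + 1)%N leq_add ?leq_b1// (leq_trans _ dle1)// -(reg_e x).
by rewrite leqNgt card_gt2.
Qed.

Local Notation P := (srw R e).

Lemma srwE x y : P x y = (e x y)%:R / d%:R.
Proof. by rewrite /srw reg_e; case: (e x y); rewrite ?mul1r ?mul0r. Qed.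

Lemma d_gt0 : 0 < d%:R :> R.
Proof. by rewrite ltr0n (leq_trans _ degree_gt1). Qed.

Lemma srw_ge0 x y : 0 <= P x y.
Proof. by rewrite srwE divr_ge0 ?ler0n. Qed.

Lemma srw_sym x y : P x y = P y x.
Proof. by rewrite !srwE; have [-> _] := simple_e. Qed.

Lemma srw_sum x : \sum_y P x y = 1.
Proof.
under eq_bigr => y _ do rewrite srwE.
have -> : \sum_y (e x y)%:R / d%:R = (\sum_(y | e x y) 1%N)%N%:R / d%:R :> R.
  by rewrite -mulr_suml natr_sum [in RHS]big_mkcond; congr (_ / _); apply: eq_bigr => y _; case: ifP.
by rewrite sum1dep_card cardsE [#|_|](reg_e x) divff// gt_eqF// d_gt0.
Qed.

(** Maximum principle: the set where [f] is maximal is closed under taking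
    neighbours, and the graph is connected.  This is what makes 1 a simple
    eigenvalue of the walk. *)
Lemma harmonic_const (f : V -> R) :
  (forall x, avg P f x = f x) -> forall x y, f x = f y.
Proof.
move=> fP.
have /card_gt0P[x0 _] : (0 < #|V|)%N by exact: leq_trans card_gt2.
pose z := [arg max_(i > x0) f i]%O.
have fz : forall w, f w <= f z by move=> w; rewrite /z; case: Order.TotalTheory.arg_maxP => // i _; apply.
suff fc : forall w, f w = f z by move=> x y; rewrite !fc.
pose A := [pred w | f w == f z].
have closedA : fingraph.closed e A.
  apply: intro_closed; first by apply: sym_connect_sym; case: simple_e.
  move=> y w eyw; rewrite !inE => /eqP fy.
  have : \sum_u P y u * (f z - f u) = 0.
    under eq_bigr => u _ do rewrite mulrBr.
    rewrite sumrB -mulr_suml srw_sum mul1r.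
    by have := fP y; rewrite /avg => ->; rewrite fy subrr.
  move=> /psumr_eq0P H; have /H/(_ w isT)/eqP : forall u, true -> 0 <= P y u * (f z - f u).
    by move=> u _; rewrite mulr_ge0 ?srw_ge0 ?subr_ge0.
  rewrite mulf_eq0 subr_eq0 srwE eyw mul1r invr_eq0 gt_eqF ?d_gt0//=.
  by rewrite eq_sym.
move=> w; have := closed_connect closedA (conn_e z w).
by rewrite !inE eqxx => /esym/eqP.
Qed.

(** Evaluate the eigenvalue equation where [`|f|] is maximal. *)
Lemma eigen_le1 (f : V -> R) (a : R) x0 : f x0 != 0 ->
  (forall x, avg P f x = a * f x) -> `|a| <= 1.
Proof.
move=> fx0 fP.
pose z := [arg max_(i > x0) `|f i|]%O.
have fz w : `|f w| <= `|f z|.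
  by rewrite /z; case: Order.TotalTheory.arg_maxP => // i _; apply.
have z0 : 0 < `|f z| by apply: lt_le_trans (fz x0); rewrite normr_gt0.
rewrite -(ler_pM2r z0) mul1r -normrM -fP.
rewrite (le_trans (ler_norm_sum _ _ _))//.
rewrite -[leRHS]mul1r -(srw_sum z) mulr_suml ler_sum// => y _.
by rewrite normrM ger0_norm ?srw_ge0// ler_wpM2l ?srw_ge0.
Qed.
End Graph.

(** * Contraction by the lazy walk *)

(** The spectral gap says nothing about negative eigenvalues, and -1 is one if
    the graph is bipartite; making the walk lazy maps the spectrum into
    [[0, 1]].  Laziness is harmless here because standing still neither costs
    time nor changes the state of the covering problem. *)
Definition lazy (R : realType) (V : finType) (e : rel V) (x y : V) : R :=
  ((x == y)%:R + srw R e x y) / 2.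

Section Graph.
Context (R : realType) (V : finType) (e : rel V) (d : nat).
Hypothesis simple_e : simple_graph e.
Hypothesis conn_e : connected_graph e.
Hypothesis reg_e : regular_graph e d.
Hypothesis card_gt2 : (2 < #|V|)%N.
Local Notation P := (srw R e).
Local Notation K := (lazy R e).

Lemma lazyE (f : V -> R) x : avg K f x = (f x + avg P f x) / 2.
Proof.
rewrite /avg /lazy; under eq_bigr => y _ do rewrite mulrAC mulrDl.
rewrite -mulr_suml big_split /= (bigD1 x)//= eqxx mul1r big1 ?addr0//.
by move=> y /negbTE; rewrite eq_sym => ->; rewrite mul0r.
Qed.

(** The eigenvalue 1 is simple, its eigenfunctions being the constants, so a
    function of mean zero has no component along it; all other eigenvalues [a]
    satisfy [-1 <= a <= 1 - g], and laziness sends them to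
    [(1 + a) / 2], between 0 and [1 - g / 2].  Simplicity of 1 is also what
    makes the gap positive. *)
Lemma spectral_gap_contraction (g := spectral_gap R e) :
  [/\ 0 < g, g <= 2 & forall f : V -> R, \sum_x f x = 0 ->
    \sum_x avg K f x ^+ 2 <= (1 - g / 2) ^+ 2 * \sum_x f x ^+ 2].
Proof.
set n := #|V|; pose A := srw_mx R e.
have AE k l : A k l = P (enum_val k) (enum_val l) by rewrite mxE.
have Asym k l : A k l = A l k by rewrite !AE (srw_sym _ simple_e reg_e).
have sumV (F : V -> R) : \sum_x F x = \sum_(i < n) F (enum_val i).
  by rewrite -big_enum_val; apply: eq_bigl.
have [D [u [v [charD [Au Av] orth pars]]]] := symmetric_spectral Asym.
have avgE (F : 'I_n -> R) x :
    avg P (F \o enum_rank) x = \sum_l A (enum_rank x) l * F l.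
  by rewrite /avg sumV; apply: eq_bigr => l _; rewrite AE /= enum_rankK enum_valK.
have Arow k : \sum_l A k l = 1.
  rewrite -(srw_sum R simple_e conn_e reg_e card_gt2 (enum_val k)) sumV.
  by apply: eq_bigr => l _; rewrite AE.
have const_eig (F : 'I_n -> R) : (forall k, \sum_l A k l * F l = F k) ->
    exists c, forall k, F k = c.
  move=> HF; have k0 : 'I_n by exists 0%N; rewrite /n; case: #|V| card_gt2.
  exists (F k0) => k.
  have /(_ (enum_val k) (enum_val k0)) : forall x y, (F \o enum_rank) x = (F \o enum_rank) y.
    by apply: (harmonic_const simple_e conn_e reg_e card_gt2) => x; rewrite avgE HF.
  by rewrite /= !enum_valK.
have transp (G f : 'I_n -> R) a : (forall k, \sum_l A k l * G l = a * G k) ->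
    \sum_k G k * (\sum_l A k l * f l) = a * \sum_k G k * f k.
  move=> HG; under eq_bigr => k _ do rewrite mulr_sumr.
  rewrite exchange_big mulr_sumr /=; apply: eq_bigr => l _.
  rewrite mulrA -HG mulr_suml; apply: eq_bigr => k _.
  by rewrite (Asym k l) mulrCA mulrA.
pose W i f := (\sum_k u i k * f k) ^+ 2 + (\sum_k v i k * f k) ^+ 2.
(* Each eigenvalue 1 carries the whole mass of the constant function, so
   Parseval's identity leaves room for only one. *)
have W1 i : D i = 1 -> exists c1 c2, [/\ forall k, u i k = c1, forall k, v i k = c2
    & W i (fun=> 1) = n%:R].
  move=> Di1.
  have [c1 uc1] : exists c, forall k, u i k = c.
    by apply: const_eig => k; rewrite Au Di1 mul1r.
  have [c2 vc2] : exists c, forall k, v i k = c.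
    by apply: const_eig => k; rewrite Av Di1 mul1r.
  exists c1, c2; split => //; rewrite /W.
  have := orth i i; rewrite eqxx; under eq_bigr => k _ do rewrite uc1 vc2.
  rewrite sumr_const card_ord => E.
  under eq_bigr => k _ do rewrite uc1 mulr1.
  under [X in _ + X ^+ 2]eq_bigr => k _ do rewrite vc2 mulr1.
  rewrite !sumr_const !card_ord -[c1 *+ n]mulr_natl -[c2 *+ n]mulr_natl.
  have E1 : n%:R * (c1 * c1 + c2 * c2) = 1 by rewrite mulr_natl; exact: E.
  transitivity (n%:R * (n%:R * (c1 * c1 + c2 * c2))); [ring | by rewrite E1 mulr1].
have sum1 : \sum_i W i (fun=> 1) = n%:R.
  by rewrite /W pars; under eq_bigr => k _ do rewrite expr1n; rewrite sumr_const card_ord.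
have W_ge0 i f : 0 <= W i f by rewrite addr_ge0 ?sqr_ge0.
have n_gt0 : 0 < n%:R :> R by rewrite ltr0n (leq_trans _ card_gt2).
have [i0 Di0] : exists i0, D i0 = 1.
  apply/not_existsP => H; suff : \sum_i W i (fun=> 1) = 0.
    by rewrite sum1 => /eqP; rewrite gt_eqF.
  apply: big1 => i _; rewrite /W.
  have Z (G : 'I_n -> R) : (forall k, \sum_l A k l * G l = D i * G k) ->
      \sum_k G k * 1 = 0.
    move=> HG; have := transp _ (fun=> 1) _ HG.
    under eq_bigr => k _ do (under eq_bigr => l _ do rewrite mulr1); rewrite //.
    under eq_bigr => k _ do rewrite Arow.
    move/eqP; rewrite -{1}[X in X == _]mul1r -subr_eq0 -mulrBl mulf_eq0 subr_eq0.
    by rewrite eq_sym => /orP[/eqP/H|/eqP].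
  by rewrite !Z// expr0n addr0.
have Duniq i : i != i0 -> D i != 1.
  move=> ii0; apply/negP => /eqP Di1.
  have [_ [_ [_ _ Wi]]] := W1 _ Di1; have [_ [_ [_ _ Wi0]]] := W1 _ Di0.
  have := sum1; rewrite (bigD1 i)//= (bigD1 i0) 1?eq_sym//= Wi Wi0.
  have : 0 <= \sum_(j < n | (j != i) && (j != i0)) W j (fun=> 1) by apply: sumr_ge0.
  lra.
have Dle1 i : `|D i| <= 1.
  have [k] : exists k, (u i k != 0) || (v i k != 0).
    apply/not_existsP => H; have := orth i i; rewrite eqxx big1.
      by move/esym/eqP; rewrite oner_eq0.
    move=> k _; have /negP := H k; rewrite negb_or !negbK => /andP[/eqP-> /eqP->].
    by rewrite !mulr0 addr0.
  have step (G : 'I_n -> R) : (forall k, \sum_l A k l * G l = D i * G k) ->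
      G k != 0 -> `|D i| <= 1.
    move=> HG Gk; apply: (eigen_le1 simple_e conn_e reg_e card_gt2 (f := G \o enum_rank) (x0 := enum_val k)).
      by rewrite /= enum_valK.
    by move=> x; rewrite avgE HG.
  by case/orP; apply: step.
(* the spectrum in nonincreasing order is [1 :: s'] *)
pose t := [seq D i | i <- rem i0 (enum 'I_n)].
have [|sort_s char_s] := @xgetPex _ [::] [set s : seq R | sorted >=%R s /\
                             char_poly A = \prod_(a <- s) ('X - a%:P)]%classic.
  exists (sort >=%R [seq D i | i <- enum 'I_n]); split.
    by apply: sort_sorted => x y; rewrite le_total.
  rewrite (perm_big _ (permEl (perm_sort _ _))) big_map big_enum; exact: charD.
rewrite -/(eigenvalues A) in sort_s char_s.
set s := eigenvalues A in sort_s char_s.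
have perm_s : perm_eq s (1 :: t).
  apply: perm_trans (_ : perm_eq [seq D i | i <- enum 'I_n] _).
    by apply: prod_XsubC_eq; rewrite -char_s big_map big_enum; exact: charD.
  rewrite -Di0 -[D i0 :: t]/[seq D i | i <- i0 :: rem i0 (enum 'I_n)].
  by apply/perm_map/perm_to_rem; rewrite mem_enum.
have memt a : a \in t -> exists2 i, i != i0 & a = D i.
  move=> /mapP[i]; rewrite mem_rem_uniq ?enum_uniq// inE => /andP[? _] ->.
  by exists i.
have size_t : (0 < size t)%N by rewrite size_map size_rem ?mem_enum// size_enum_ord /n; case: #|V| card_gt2 => [|[|]].
have [s' sE] : exists s', s = 1 :: s'.
  case: s sort_s perm_s {char_s} => [|a s']; first by move=> _ /perm_size.
  move=> /= path_s perm_s; exists s'; congr (_ :: _); apply/eqP; rewrite eq_le.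
  apply/andP; split.
    have : a \in 1 :: t by rewrite -(perm_mem perm_s) mem_head.
    rewrite inE => /orP[/eqP->//|/memt[i _ ->]].
    by rewrite (le_trans (ler_norm _)).
  have : 1 \in a :: s' by rewrite (perm_mem perm_s) mem_head.
  rewrite inE => /orP[/eqP->//|].
  by have /allP := order_path_min ge_trans path_s; apply.
move: perm_s sort_s; rewrite sE perm_cons => perm_t path_s.
have gE : g = 1 - s'`_0 by rewrite /g /spectral_gap -/A -/s sE.
have s'0 : s'`_0 \in s' by rewrite mem_nth// (perm_size perm_t).
have [j jj0 s'0E] : exists2 i, i != i0 & s'`_0 = D i by apply: memt; rewrite -(perm_mem perm_t).
have Dmax i : i != i0 -> D i <= s'`_0.
  move=> ii0; have : D i \in s'.
    rewrite (perm_mem perm_t); apply/map_f.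
    by rewrite mem_rem_uniq ?enum_uniq// inE ii0 mem_enum.
  case: s' path_s {sE perm_t gE s'0 s'0E} => // a s' /= /andP[_ path_s].
  rewrite inE => /orP[/eqP->//|].
  by have /allP := order_path_min ge_trans path_s; apply.
have /andP[Dj1 Dj2] : -1 <= D j <= 1 by rewrite -ler_norml.
have Dj3 : D j < 1 by rewrite lt_neqAle Duniq.
split; rewrite ?gE ?s'0E; [lra|lra|].
move=> f f0.
pose F (i : 'I_n) := f (enum_val i); pose F' (i : 'I_n) := avg K f (enum_val i).
have FE x : f x = F (enum_rank x) by rewrite /F enum_rankK.
have F'E i : F' i = (F i + \sum_l A i l * F l) / 2.
  rewrite /F' lazyE; congr ((_ + _) / _).
  have -> : avg P f (enum_val i) = avg P (F \o enum_rank) (enum_val i).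
    by apply: eq_bigr => y _; rewrite /= -FE.
  by rewrite avgE enum_valK.
rewrite !sumV -[X in X <= _](pars F') -[X in _ <= _ * X](pars F) mulr_sumr.
apply: ler_sum => i _; rewrite -/(W i F) -/(W i F').
have WF' : W i F' = ((1 + D i) / 2) ^+ 2 * W i F.
  rewrite /W.
  have half (G : 'I_n -> R) : (forall k, \sum_l A k l * G l = D i * G k) ->
      \sum_k G k * F' k = (1 + D i) / 2 * \sum_k G k * F k.
    move=> HG; under eq_bigr => k _ do rewrite F'E mulrA mulrDr.
    by rewrite -mulr_suml big_split /= (transp _ _ _ HG); ring.
  by rewrite !half//; ring.
rewrite WF'; have [->|ii0] := eqVneq i i0.
  have [c1 [c2 [uc vc _]]] := W1 _ Di0.
  rewrite /W; under eq_bigr => k _ do rewrite uc.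
  under [X in _ + X ^+ 2]eq_bigr => k _ do rewrite vc.
  by rewrite -!mulr_sumr /F -sumV f0 !mulr0 expr0n addr0 !mulr0.
rewrite ler_wpM2r//.
have := Dmax i ii0; have := Dle1 i; rewrite ler_norml s'0E => /andP[? ?] ?.
by rewrite ler_sqr ?nnegrE; lra.
Qed.
End Graph.

(** * Inhomogeneous walks and their visits *)

(** Weighted arithmetic-geometric mean inequality of [t] and 1.  It gives the
    boosting inequality [powR_avg_le] and, with [eta = 1 - q], the estimate of
    the sums of powers in [sum_powR_le]. *)
Lemma powR_le_affine (R : realType) (eta t : R) :
  0 <= eta -> eta <= 1 -> 0 <= t -> t `^ (1 - eta) <= (1 - eta) * t + eta.
Proof.
move=> e0 e1; rewrite le_eqVlt => /orP[/eqP<-|t0].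
  have [->|ne1] := eqVneq eta 1; first by rewrite subrr powRr0 mul0r add0r.
  by rewrite powR0 ?mulr0 ?add0r// subr_eq0 eq_sym.
set u := (1 - eta) * t + eta.
have u0 : 0 < u.
  rewrite /u; have [->|ne1] := eqVneq eta 1; first by rewrite subrr mul0r add0r.
  have : 0 < (1 - eta) * t by rewrite mulr_gt0// subr_gt0 lt_neqAle ne1.
  lra.
rewrite /powR gt_eqF// -[leRHS](lnK (x := u)) ?posrE// ler_expR.
have lnle (y : R) : 0 < y -> ln y <= y - 1.
  by move=> y0; rewrite -[in leLHS](subrKC 1 y) le_ln1Dx//; lra.
have := lnle _ (divr_gt0 t0 u0); have := lnle _ (divr_gt0 ltr01 u0).
rewrite !ln_div ?posrE// ln1 => h1 h2.
have h3 : (1 - eta) * (ln t - ln u) <= (1 - eta) * (t / u - 1).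
  by rewrite ler_wpM2l// subr_ge0.
have h4 : eta * (0 - ln u) <= eta * (1 / u - 1) by rewrite ler_wpM2l.
have : (1 - eta) * (t / u - 1) + eta * (1 / u - 1) = 0.
  by rewrite -(subrr (u / u)) {3}/u ; field; rewrite gt_eqF.
lra.
Qed.

Section Kernel.
Context (R : realType) (V : finType).
Implicit Types (Q K : V -> V -> R) (f g h : V -> R) (Qs : seq (V -> V -> R)) (U : {set V}).

(** A time-inhomogeneous walk is given by the list of its transition
    kernels. *)
Definition all_kernels (p : (V -> V -> R) -> Prop) Qs : Prop :=
  foldr (fun Q b => p Q /\ b) True Qs.

Lemma all_kernels_cat p Qs1 Qs2 :
  all_kernels p (Qs1 ++ Qs2) <-> all_kernels p Qs1 /\ all_kernels p Qs2.
Proof. by elim: Qs1 => [|Q Qs IH] /=; tauto. Qed.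

Fixpoint run Qs f : V -> R := if Qs is Q :: Qs' then avg Q (run Qs' f) else f.

(** The expected number of visits to [U], the starting point not being
    counted, as [U] will consist of vertices yet to be visited. *)
Fixpoint visits Qs U : V -> R :=
  if Qs is Q :: Qs' then avg Q (fun y => (y \in U)%:R + visits Qs' U y)
  else fun=> 0.

Lemma avgD Q f g x : avg Q (fun y => f y + g y) x = avg Q f x + avg Q g x.
Proof. by rewrite -big_split /=; apply: eq_bigr => y _; rewrite mulrDr. Qed.

Lemma eq_avg Q f g : f =1 g -> avg Q f =1 avg Q g.
Proof. by move=> fg x; apply: eq_bigr => y _; rewrite fg. Qed.

Lemma visits_cat Qs1 Qs2 U x :
  visits (Qs1 ++ Qs2) U x = visits Qs1 U x + run Qs1 (visits Qs2 U) x.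
Proof.
elim: Qs1 x => [|Q Qs IH] x /=; first by rewrite add0r.
rewrite -avgD; apply: eq_avg => y.
by rewrite IH addrA.
Qed.

(** Additivity over the vertices of [U] is what allows [round_bound] to delete
    visited vertices from [U] one at a time. *)
Lemma visits_set Qs U x : visits Qs U x = \sum_(u in U) visits Qs [set u] x.
Proof.
elim: Qs x => [|Q Qs IH] x /=; first by rewrite big1.
rewrite /avg exchange_big /=; apply: eq_bigr => y _.
rewrite -mulr_sumr big_split /= IH; congr (_ * (_ + _)).
under eq_bigr => u _ do rewrite inE.
case: (boolP (y \in U)) => yU.
  rewrite (bigD1 y)//= eqxx big1 ?addr0// => u /andP[_ /negbTE].
  by rewrite eq_sym => ->.
by rewrite big1// => u uU; case: eqP => // yu; rewrite yu uU in yU.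
Qed.

(** Domination by [alpha * K] with [alpha] close to 1 is how a slightly biased
    kernel inherits the mixing and return estimates of [K]. *)
Record tame K (alpha : R) Q : Prop := Tame {
  tame_ge0 : forall x y, 0 <= Q x y ;
  tame_sum : forall x, \sum_y Q x y = 1 ;
  tame_le : forall x y, Q x y <= alpha * K x y }.

Lemma avg_le Q f g : (forall x y, 0 <= Q x y) -> (forall x, f x <= g x) ->
  forall x, avg Q f x <= avg Q g x.
Proof. by move=> Q0 fg x; apply: ler_sum => y _; rewrite ler_wpM2l. Qed.

Lemma run_le K alpha Qs f g : all_kernels (tame K alpha) Qs ->
  (forall x, f x <= g x) -> forall x, run Qs f x <= run Qs g x.
Proof.
move=> + fg; elim: Qs => //= Q Qs IH [[Q0 _ _] HQs].
by apply: avg_le => //; exact: IH.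
Qed.

Lemma visits_ge0 K alpha Qs U x : all_kernels (tame K alpha) Qs -> 0 <= visits Qs U x.
Proof.
elim: Qs x => //= Q Qs IH x [[Q0 _ _] HQs].
by apply: sumr_ge0 => y _; rewrite mulr_ge0// addr_ge0 ?ler0n ?IH.
Qed.

(** The reduction of [f] is [D / (1 + r)] per expected visit rather than per
    expected new vertex: once [u] has been reached, it is visited at most
    [1 + r] times in expectation, counting the present visit.  Concretely,
    [visits Qs U x] is a martingale while no vertex of [U] is met, and loses
    only [visits Qs [set u] u <= r] when [u] is removed from [U].  Hence the
    induction needs no independence between the walk and the set of vertices
    that it has already covered. *)
Lemma round_bound (f : V -> {set V} -> R) K alpha Qs (A D r : R) (m : nat) :
  0 <= A -> 0 <= D -> 0 <= r ->
  (forall x, f x finset.set0 = 0) ->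
  all_kernels (tame K alpha) Qs ->
  all_kernels (fun Q => forall x U, x \notin U -> U != finset.set0 ->
     f x U <= 1 + \sum_y Q x y * f y (U :\ y)) Qs ->
  (forall k u, visits (drop k Qs) [set u] u <= r) ->
  (forall x U, x \notin U -> (#|U| <= m)%N -> f x U <= A + D * #|U|%:R) ->
  forall x U, x \notin U -> (#|U| <= m)%N ->
    f x U <= (size Qs)%:R + A + D * #|U|%:R - D / (1 + r) * visits Qs U x.
Proof.
move=> A0 D0 r0 f0 + + + fA; elim: Qs => [|Q Qs IH] /=.
  by move=> _ _ _ x U xU Um; rewrite mulr0 subr0 add0r fA.
move=> [[Q0 Q1 _] HQs] [stepQ HstepQs] Hr x U xU Um.
have [->|U0] := eqVneq U finset.set0.
  rewrite f0 cards0 mulr0 addr0 [avg _ _ _]big1 ?mulr0 ?subr0 ?addr_ge0//.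
  move=> y _; rewrite inE add0r visits_set big_set0.
  by rewrite mulr0.
rewrite (le_trans (stepQ _ _ xU U0))//.
rewrite -natr1 -!addrA [leRHS]addrC -!addrA lerD2l.
set c : R := D / (1 + r).
rewrite !addrA.
have c0 : 0 <= c by rewrite divr_ge0// addr_ge0.
have -> : A + D * #|U|%:R - c * avg Q (fun y => (y \in U)%:R + visits Qs U y) x + (size Qs)%:R =
  \sum_y Q x y * ((size Qs)%:R + A + D * #|U|%:R - c * ((y \in U)%:R + visits Qs U y)).
  under [RHS]eq_bigr => y _ do rewrite mulrBr mulrCA.
  by rewrite sumrB -mulr_suml Q1 -mulr_sumr mul1r /avg /visits; ring.
apply: ler_sum => y _; rewrite ler_wpM2l//.
have Uy : (#|U :\ y| <= m)%N by rewrite (leq_trans _ Um)// subset_leq_card// subD1set.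
have IHy : f y (U :\ y) <= (size Qs)%:R + A + D * #|U :\ y|%:R - c * visits Qs (U :\ y) y.
  apply: IH => //; last by rewrite !inE eqxx.
  by move=> k u; exact: (Hr k.+1).
rewrite (le_trans IHy)//.
have [yU|yU] := boolP (y \in U).
  have -> : #|U|%:R = 1 + #|U :\ y|%:R :> R by rewrite (cardsD1 y U) yU natrD.
  have -> : visits Qs U y = visits Qs [set y] y + visits Qs (U :\ y) y.
    rewrite !(visits_set _ U) (visits_set _ (U :\ y)) (big_setD1 y)//=.
  have Hy : visits Qs [set y] y <= r by have := Hr 1%N y; rewrite /= drop0.
  have : c * (1 + visits Qs [set y] y) <= D.
    have -> : D = c * (1 + r) by rewrite /c divfK// gt_eqF// ltr_wpDr.
    by rewrite ler_wpM2l// lerD2l.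
  by rewrite /=; lra.
have -> : U :\ y = U.
  by apply/setP => z; rewrite !inE; case: eqVneq => // ->; rewrite (negbTE yU).
by rewrite /= add0r.
Qed.

End Kernel.

(** * Mixing and returns *)

Lemma norm_le_sqr (R : realDomainType) (a c : R) :
  0 <= c -> a ^+ 2 <= c ^+ 2 -> `|a| <= c.
Proof.
by move=> c0; rewrite -(real_normK (num_real a)) ler_sqr ?nnegrE.
Qed.

Section Mixing.
Context (R : realType) (V : finType) (K : V -> V -> R) (rho : R).
Hypothesis K_ge0 : forall x y, 0 <= K x y.
Hypothesis K_sum : forall x, \sum_y K x y = 1.
Hypothesis K_sym : forall x y, K x y = K y x.
Hypothesis K_contr : forall f : V -> R, \sum_x f x = 0 ->
  \sum_x avg K f x ^+ 2 <= rho ^+ 2 * \sum_x f x ^+ 2.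
Hypothesis V_gt0 : (0 < #|V|)%N.
Local Notation n := (#|V|%:R : R).
Implicit Types (Q : V -> V -> R) (f g h : V -> R) (Qs : seq (V -> V -> R)) (U : {set V}).

(** Mean and (unnormalised) variance with respect to the uniform measure, which
    is stationary since [K] is symmetric. *)
Definition mean f : R := (\sum_x f x) / n.
Definition var f : R := \sum_x (f x - mean f) ^+ 2.

Lemma n_gt0 : 0 < n.
Proof. by rewrite ltr0n. Qed.

Lemma sum_mean f : \sum_x f x = n * mean f.
Proof. by rewrite /mean mulrC divfK// gt_eqF// n_gt0. Qed.

Lemma eq_mean f g : f =1 g -> mean f = mean g.
Proof. by move=> fg; rewrite /mean (eq_bigr _ (fun x _ => fg x)). Qed.

Lemma mean_le f g : (forall x, f x <= g x) -> mean f <= mean g.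
Proof. by move=> fg; rewrite ler_pM2r ?invr_gt0 ?n_gt0//; apply: ler_sum. Qed.

Lemma meanD f g : mean (fun x => f x + g x) = mean f + mean g.
Proof. by rewrite /mean big_split mulrDl. Qed.

Lemma meanZ c f : mean (fun x => c * f x) = c * mean f.
Proof. by rewrite /mean -mulr_sumr mulrA. Qed.

Lemma mean_cst c : mean (fun=> c) = c.
Proof. by rewrite /mean sumr_const -[c *+ _]mulr_natr mulfK// gt_eqF// n_gt0. Qed.

Lemma sum_sqr_dev f c : \sum_x (f x - c) ^+ 2 = var f + n * (mean f - c) ^+ 2.
Proof.
rewrite /var; set m := mean f.
have -> : \sum_x (f x - c) ^+ 2 =
    \sum_x ((f x - m) ^+ 2 + (2 * (m - c)) * f x + (c ^+ 2 - m ^+ 2)).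
  by apply: eq_bigr => x _; ring.
rewrite big_split big_split /= -mulr_sumr (sum_mean f) sumr_const -[(_ - _) *+ _]mulr_natl -/m; ring.
Qed.

Lemma var_ge0 f : 0 <= var f.
Proof. by apply: sumr_ge0 => x _; rewrite sqr_ge0. Qed.

Lemma var_le f c : var f <= \sum_x (f x - c) ^+ 2.
Proof. by rewrite sum_sqr_dev lerDl mulr_ge0 ?sqr_ge0// ltW// n_gt0. Qed.

Lemma mean_dev f c : n * (mean f - c) ^+ 2 <= \sum_x (f x - c) ^+ 2.
Proof. by rewrite sum_sqr_dev lerDr var_ge0. Qed.

Lemma point_dev f x : (f x - mean f) ^+ 2 <= var f.
Proof.
rewrite /var (bigD1 x)//= lerDl; apply: sumr_ge0 => y _; exact: sqr_ge0.
Qed.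

Lemma mean_avg f : mean (avg K f) = mean f.
Proof.
rewrite /mean /avg exchange_big /=; congr (_ / _); apply: eq_bigr => y _.
by rewrite -mulr_suml (eq_bigr _ (fun x _ => K_sym x y)) K_sum mul1r.
Qed.

Lemma var_avg f : var (avg K f) <= rho ^+ 2 * var f.
Proof.
rewrite /var mean_avg; set m := mean f.
have -> : \sum_x (avg K f x - m) ^+ 2 = \sum_x avg K (fun y => f y - m) x ^+ 2.
  apply: eq_bigr => x _; congr (_ ^+ 2).
  rewrite /avg; under [RHS]eq_bigr => y _ do rewrite mulrBr.
  by rewrite sumrB -mulr_suml K_sum mul1r.
by apply: K_contr; rewrite sumrB sum_mean sumr_const -[m *+ _]mulr_natl subrr.
Qed.

Lemma mean_iter j f : mean (iter j (avg K) f) = mean f.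
Proof. by elim: j => //= j IH; rewrite mean_avg. Qed.

Lemma var_iter j f : var (iter j (avg K) f) <= (rho ^+ 2) ^+ j * var f.
Proof.
elim: j => [|j IH]; first by rewrite expr0 mul1r.
by rewrite iterS (le_trans (var_avg _))// [_ ^+ j.+1]exprS -mulrA ler_wpM2l// sqr_ge0.
Qed.

Lemma iter_ge j f x (c : R) : 0 <= c -> (rho ^+ 2) ^+ j * var f <= c ^+ 2 ->
  mean f - c <= iter j (avg K) f x.
Proof.
move=> c0 H; have := le_trans (point_dev (iter j (avg K) f) x) (le_trans (var_iter j f) H).
rewrite mean_iter => /(norm_le_sqr c0).
by rewrite ler_norml => /andP[? _]; lra.
Qed.

Lemma iter_le j f x (c : R) : 0 <= c -> (rho ^+ 2) ^+ j * var f <= c ^+ 2 ->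
  iter j (avg K) f x <= mean f + c.
Proof.
move=> c0 H; have := le_trans (point_dev (iter j (avg K) f) x) (le_trans (var_iter j f) H).
rewrite mean_iter => /(norm_le_sqr c0).
by rewrite ler_norml => /andP[_ ?]; lra.
Qed.

Lemma run_nseq j f x : run (nseq j K) f x = iter j (avg K) f x.
Proof. by elim: j x => //= j IH x; apply: eq_avg. Qed.

Lemma tame_refl alpha : 1 <= alpha -> tame K alpha K.
Proof. by move=> a1; split=> // x y; rewrite ler_peMl. Qed.

(** Jensen's inequality. *)
Lemma sqr_avg_le Q g x : (forall y, 0 <= Q x y) -> \sum_y Q x y = 1 ->
  avg Q g x ^+ 2 <= avg Q (fun y => g y ^+ 2) x.
Proof.
move=> Q0 Q1; rewrite -subr_ge0; set m := avg Q g x.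
have -> : avg Q (fun y => g y ^+ 2) x - m ^+ 2 = \sum_y Q x y * (g y - m) ^+ 2.
  have -> : \sum_y Q x y * (g y - m) ^+ 2 =
      \sum_y (Q x y * g y ^+ 2 + (- 2 * m) * (Q x y * g y) + m ^+ 2 * Q x y).
    by apply: eq_bigr => y _; ring.
  rewrite !big_split /= -!mulr_sumr Q1 -/(avg Q g x) -/m /avg; ring.
by apply: sumr_ge0 => y _; rewrite mulr_ge0// sqr_ge0.
Qed.

Lemma tame_sqr alpha Q g : tame K alpha Q ->
  \sum_x avg Q g x ^+ 2 <= alpha * \sum_x g x ^+ 2.
Proof.
move=> [Q0 Q1 QK].
apply: le_trans (_ : \sum_x \sum_y (alpha * K x y) * g y ^+ 2 <= _).
  apply: ler_sum => x _; rewrite (le_trans (sqr_avg_le _ _ _))//.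
  by apply: ler_sum => y _; rewrite ler_wpM2r// sqr_ge0.
rewrite exchange_big mulr_sumr; apply: ler_sum => y _ /=.
rewrite -mulr_suml -mulr_sumr (eq_bigr _ (fun x _ => K_sym x y)) K_sum mulr1.
exact: lexx.
Qed.

(** A tame kernel is not self-adjoint and need not contract, but by Jensen's
    inequality it expands squared distances to a constant by at most
    [alpha]. *)
Lemma run_sqr_dev alpha Qs f c : 0 <= alpha -> all_kernels (tame K alpha) Qs ->
  \sum_x (run Qs f x - c) ^+ 2 <= alpha ^+ size Qs * \sum_x (f x - c) ^+ 2.
Proof.
move=> a0; elim: Qs => [|Q Qs IH] /=; first by rewrite expr0 mul1r.
move=> [tQ HQs]; rewrite exprS -mulrA (le_trans _ (ler_wpM2l a0 (IH HQs)))//.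
rewrite (le_trans _ (tame_sqr _ tQ))//; apply: ler_sum => x _.
suff -> : avg Q (run Qs f) x - c = avg Q (fun y => run Qs f y - c) x by [].
rewrite /avg; under [RHS]eq_bigr => y _ do rewrite mulrBr.
by rewrite sumrB -mulr_suml (tame_sum tQ) mul1r.
Qed.

(** The return probability of the reference walk is stationary up to an error
    decaying at the rate of the spectral gap. *)
Lemma diag_iter u j : 0 <= rho -> iter j (avg K) (fun y => (y \in [set u])%:R) u <= n^-1 + rho ^+ j.
Proof.
move=> rho0; set f := fun y => _.
have sumf : \sum_y f y = 1.
  by rewrite (bigD1 u)//= /f inE eqxx big1 ?addr0// => y /negbTE; rewrite inE => ->.
have mf : mean f = n^-1 by rewrite /mean sumf mul1r.
rewrite -mf; apply: iter_le; first exact: exprn_ge0.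
rewrite -!exprM mulnC -[leRHS]mulr1 ler_wpM2l ?exprn_ge0//.
rewrite (le_trans (var_le _ 0))// -sumf; apply: ler_sum => y _.
by rewrite subr0 /f; case: (_ \in _); rewrite ?expr1n ?expr0n.
Qed.

Lemma visits_le_iter alpha Qs U x : 0 <= alpha -> all_kernels (tame K alpha) Qs ->
  visits Qs U x <= \sum_(j < size Qs) alpha ^+ j.+1 *
    iter j.+1 (avg K) (fun y => (y \in U)%:R) x.
Proof.
move=> a0; elim: Qs x => [|Q Qs IH] x /=; first by rewrite big_ord0.
move=> [[Q0 Q1 QK] HQs].
set F := fun y => (y \in U)%:R.
apply: le_trans (_ : \sum_y alpha * K x y * (F y + \sum_(j < size Qs) alpha ^+ j.+1 *
    iter j.+1 (avg K) F y) <= _).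
  apply: ler_sum => y _; have v0 := visits_ge0 U y HQs.
  apply: ler_pM; rewrite ?QK ?lerD2l ?IH ?addr_ge0 ?ler0n//.
rewrite big_ord_recl expr1 /= /avg.
under eq_bigr => y _ do rewrite mulrDr.
rewrite big_split /= lerD//.
  by rewrite mulr_sumr; apply: ler_sum => y _; rewrite mulrA.
under eq_bigr => y _ do rewrite mulr_sumr.
rewrite exchange_big /=; apply: ler_sum => j _.
rewrite mulr_sumr; apply: ler_sum => y _.
rewrite /bump /= add1n !exprS le_eqVlt; apply/orP; left; apply/eqP; ring.
Qed.

(** Compare with the reference walk: the bias costs a factor [alpha ^+ j] at
    time [j], which the exponential decay of the return probabilities absorbs;
    the stationary part [1 / n] only contributes the second summand, which will
    be small because the walk makes [O(log n)] steps. *)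
Lemma returns_le alpha Qs u (theta : R) : 1 <= alpha -> 0 <= rho ->
  alpha * rho <= 1 - theta -> 0 < theta ->
  all_kernels (tame K alpha) Qs ->
  visits Qs [set u] u <= theta^-1 + (size Qs)%:R * alpha ^+ size Qs / n.
Proof.
move=> a1 r0 ar th HQs; have a0 : 0 <= alpha by exact: le_trans a1.
rewrite (le_trans (visits_le_iter _ _ a0 HQs))//.
apply: le_trans (_ : \sum_(j < size Qs) ((1 - theta) ^+ j.+1 + alpha ^+ size Qs / n) <= _).
  apply: ler_sum => j _.
  apply: le_trans (ler_wpM2l (exprn_ge0 _ a0) (diag_iter _ _ r0)) _.
  rewrite mulrDr addrC lerD//.
    by rewrite -exprMn lerXn2r ?nnegrE ?mulr_ge0// (le_trans _ ar) ?mulr_ge0.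
  by rewrite ler_wpM2r ?invr_ge0// ler_weXn2l.
rewrite big_split /= lerD//; last by rewrite sumr_const card_ord -[(_ / _) *+ _]mulr_natl mulrA.
have t0 : 0 <= 1 - theta by rewrite (le_trans _ ar) ?mulr_ge0.
have : theta * \sum_(j < size Qs) (1 - theta) ^+ j.+1 <= 1.
  have -> : \sum_(j < size Qs) (1 - theta) ^+ j.+1 = (1 - theta) * \sum_(j < size Qs) (1 - theta) ^+ j.
    by rewrite mulr_sumr; apply: eq_bigr => j _; rewrite exprS.
  have := subrX1 (1 - theta) (size Qs) => E.
  rewrite mulrCA.
  have -> : theta * \sum_(i < size Qs) (1 - theta) ^+ i = 1 - (1 - theta) ^+ size Qs.
    rewrite -[1 - _ ^+ _]opprB E -mulNr; congr (_ * _); ring.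
  have e0 : 0 <= (1 - theta) ^+ size Qs by exact: exprn_ge0.
  by rewrite (le_trans (ler_wpM2l t0 (_ : _ <= 1)))//; lra.
by rewrite -[X in _ -> _ <= X]mul1r ler_pdivlMr// mulrC.
Qed.

End Mixing.

(** * Boosting by a small bias *)

Section Powers.
Context (R : realType) (p : R).
Hypothesis p_gt0 : 0 < p.
Hypothesis p_le1 : p <= 1.

Lemma powR_ge_id (t : R) : 0 <= t -> t <= 1 -> t <= t `^ p.
Proof.
rewrite le_eqVlt => /orP[/eqP<- _|t0 t1]; first exact: powR_ge0.
by rewrite ger1_powR// t0.
Qed.

(** Both sides are compared with [min t 1].  The point is that the left-hand
    side only involves the first two moments of [t]. *)
Lemma powR_ge_parabola (t : R) : 0 <= t -> t - t ^+ 2 / 4 <= t `^ p.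
Proof.
move=> t0; have t2 := sqr_ge0 t; have [t1|t1] := leP t 1.
  by have := powR_ge_id t0 t1; lra.
have : 1 <= t `^ p by have := ler_powR (ltW t1) (ltW p_gt0); rewrite powRr0.
have := sqr_ge0 (t / 2 - 1); nra.
Qed.

Lemma powR_sqr_le (t : R) : 0 <= t -> (t `^ p) ^+ 2 <= 1 + t ^+ 2.
Proof.
move=> t0; have t2 := sqr_ge0 t; have q0 := powR_ge0 t p; have [t1|t1] := leP t 1.
  have : t `^ p <= 1.
    have := ge0_ler_powR (ltW p_gt0) t0 ler01 t1; rewrite powR1; exact.
  by nra.
have : t `^ p <= t by rewrite ler1_powR// ltW.
nra.
Qed.

(** Subadditivity of concave powers; it lets a boosted walk collect a reward of
    1 at each visit. *)
Lemma powR_add_bool (b : bool) (h : R) : 0 <= h ->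
  (b%:R + h) `^ p <= b%:R + h `^ p.
Proof.
move=> h0; case: b => /=; rewrite ?mulr1n ?mulr0n; last by rewrite !add0r.
set w := 1 + h; have w1 : 1 <= w by rewrite lerDl.
have w0 : 0 < w by exact: lt_le_trans w1.
have hw : h = w * (h / w) by rewrite mulrCA divff ?mulr1// gt_eqF.
have ww : 1 = w * w^-1 by rewrite divff// gt_eqF.
have wV : 0 <= w^-1 by rewrite invr_ge0 ltW.
have hV : 0 <= h / w by rewrite mulr_ge0.
have e1 : h `^ p = w `^ p * (h / w) `^ p by rewrite [in LHS]hw powRM// ltW.
have e2 : w `^ p * w^-1 `^ p = 1.
  by transitivity ((w / w) `^ p); [rewrite powRM// ltW | rewrite -ww powR1].
rewrite e1 -[X in X + _]e2 -mulrDr -[leLHS]mulr1 ler_wpM2l ?powR_ge0//.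
have -> : 1 = w^-1 + h / w.
  by rewrite -[X in X + _]mul1r -mulrDl divff// gt_eqF.
rewrite lerD// powR_ge_id//; first by rewrite invf_le1.
by rewrite ler_pdivrMr// mul1r lerDr.
Qed.
End Powers.

Section Boost.
Context (R : realType) (V : finType) (K : V -> V -> R) (eta : R).
Hypothesis K_ge0 : forall x y, 0 <= K x y.
Hypothesis K_sum : forall x, \sum_y K x y = 1.
Hypothesis eta_ge0 : 0 <= eta.
Hypothesis eta_lt1 : eta < 1.
Local Notation p := (1 - eta).
Implicit Types (f g h : V -> R) (U : {set V}).

Let p_gt0 : 0 < p. Proof. by rewrite subr_gt0. Qed.
Let p_le1 : p <= 1. Proof. by rewrite gerBl. Qed.

(** With probability [eta] the walk moves deterministically to [b x]. *)
Definition biased (b : V -> V) (x y : V) : R := p * K x y + eta * (b x == y)%:R.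

Definition supported_choice (b : V -> V) : Prop := forall x, 0 < K x (b x).

Lemma biasedE b f x : avg (biased b) f x = p * avg K f x + eta * f (b x).
Proof.
rewrite /avg /biased; under eq_bigr => y _ do rewrite mulrDl -!mulrA.
rewrite big_split /= -!mulr_sumr [X in _ + eta * X](bigD1 (b x))//= eqxx mul1r [X in eta * (_ + X)]big1 ?addr0//.
by move=> y /negbTE; rewrite eq_sym => ->; rewrite mul0r.
Qed.

Lemma tame_biased b kap : 0 <= kap -> (forall x y, 0 < K x y -> 1 <= kap * K x y) ->
  supported_choice b -> tame K (1 + kap * eta) (biased b).
Proof.
move=> kap0 Hkap Hb; split=> [x y|x|x y].
- by rewrite addr_ge0// mulr_ge0// ?ler0n// ltW.
- have := biasedE b (fun=> 1) x; rewrite /avg.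
  under eq_bigr => y _ do rewrite mulr1.
  by under [in X in _ = X -> _]eq_bigr => y _ do rewrite mulr1; rewrite K_sum => ->; ring.
- rewrite /biased [leRHS]mulrDl [in leRHS]mul1r lerD//; first by rewrite ler_piMl.
  rewrite mulrAC [leRHS]mulrC ler_wpM2l//.
  by case: eqP => [<-|_]; rewrite ?Hkap// mulr_ge0.
Qed.

(** Boosting: a bias [eta] towards the best neighbour [y] turns the average of
    [f] into its power [1 - eta].  Writing [M] for the maximum [f y], concavity
    gives [f z `^ p >= M `^ p * (f z / M)], and what remains is
    [powR_le_affine] for the ratio of the average to [M]. *)
Lemma powR_avg_le f x y : (forall z, 0 <= f z) ->
  (forall z, 0 < K x z -> f z <= f y) ->
  avg K f x `^ p <= p * avg K (fun z => f z `^ p) x + eta * f y `^ p.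
Proof.
move=> f0 fy; set M := f y; have := f0 y; rewrite le_eqVlt -/M => /orP[/eqP M0|M0].
  have -> : avg K f x = 0.
    apply: big1 => z _; have := K_ge0 x z; rewrite le_eqVlt => /orP[/eqP<-|Kz].
      by rewrite mul0r.
    by have -> : f z = 0; [apply/eqP; rewrite eq_le f0 M0 fy | rewrite mulr0].
  rewrite powR0 ?gt_eqF// addr_ge0// ?mulr_ge0 ?powR_ge0// ?sumr_ge0//; first exact: ltW.
  by move=> z _; rewrite mulr_ge0 ?powR_ge0.
set t := avg K f x / M.
have a0 : 0 <= avg K f x by apply: sumr_ge0 => z _; rewrite mulr_ge0.
have t0 : 0 <= t by rewrite divr_ge0// ltW.
have -> : avg K f x = M * t by rewrite /t mulrCA divff ?mulr1// gt_eqF.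
rewrite powRM ?(ltW M0)//.
apply: le_trans (_ : M `^ p * (p * t + eta) <= _).
  by rewrite ler_wpM2l ?powR_ge0// powR_le_affine// ltW.
rewrite mulrDr lerD//; last by rewrite mulrC.
rewrite mulrCA.
rewrite ler_wpM2l ?(ltW p_gt0)// /t /avg mulr_suml mulr_sumr ler_sum// => z _.
have := K_ge0 x z; rewrite le_eqVlt => /orP[/eqP<-|Kz]; first by rewrite !mul0r mulr0.
rewrite -!mulrA [leLHS]mulrCA ler_pM2l//.
have -> : f z `^ p = M `^ p * (f z / M) `^ p.
  by rewrite -powRM ?divr_ge0 ?(ltW M0)// mulrCA divff ?mulr1// gt_eqF.
rewrite ler_wpM2l ?powR_ge0// powR_ge_id ?divr_ge0 ?(ltW M0)//.
by rewrite ler_pdivrMr// mul1r fy.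
Qed.

Lemma exists_boost f : (forall z, 0 <= f z) ->
  exists2 b, supported_choice b & forall x, avg K f x `^ p <= avg (biased b) (fun z => f z `^ p) x.
Proof.
move=> f0.
have /choice[b Hb] : forall x, exists y, 0 < K x y /\ forall z, 0 < K x z -> f z <= f y.
  move=> x; have [y0 Ky0] : exists y, 0 < K x y.
    apply/not_existsP => H; have := K_sum x; rewrite big1 => [/esym/eqP|y _].
      by rewrite oner_eq0.
    by apply/eqP; rewrite eq_le K_ge0 andbT leNgt; apply/negP.
  exists [arg max_(y > y0 | 0 < K x y) f y]%O.
  by case: Order.TotalTheory.arg_maxP.
exists b; first by move=> x; case: (Hb x).
move=> x; rewrite biasedE; apply: powR_avg_le => //.
by case: (Hb x).
Qed.

Definition boosted (Q : V -> V -> R) : Prop := exists2 b, supported_choice b & Q = biased b.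

(** One step of dynamic programming, from the end of the walk backwards: if the
    remaining steps yield [f `^ p] expected visits, then a suitably biased
    first step yields the same power of the unbiased expectation. *)
Lemma boost_visits f U Qs : (forall z, 0 <= f z) ->
  (forall x, f x `^ p <= visits Qs U x) ->
  exists2 Q, boosted Q &
    forall x, avg K (fun y => (y \in U)%:R + f y) x `^ p <= visits (Q :: Qs) U x.
Proof.
move=> f0 Hf.
have [|b Hb HQ] := @exists_boost (fun y => (y \in U)%:R + f y).
  by move=> z; rewrite addr_ge0 ?ler0n.
exists (biased b); first by exists b.
move=> x; rewrite (le_trans (HQ x))//= avg_le//.
  by move=> y z; rewrite addr_ge0// mulr_ge0// ?ler0n// ltW.
move=> y; rewrite (le_trans (powR_add_bool p_le1 _ (f0 y)))//.
by rewrite lerD2l.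
Qed.

(** With [s] the density of [U], the unbiased expectation below is about
    [j * s]; a biased walk reaches [(j * s) `^ p], which is much larger when
    [s] is small.  The visits are counted during the last [j] steps only: the
    first [i] steps make the expectation nearly independent of [x]. *)
Lemma boosted_window U i j : exists Ws, [/\ size Ws = (i + j)%N,
  all_kernels boosted Ws &
  forall x, iter i (avg K) (visits (nseq j K) U) x `^ p <= visits Ws U x].
Proof.
have v0 k x : 0 <= visits (nseq k K) U x.
  elim: k x => //= k IH x; apply: sumr_ge0 => y _.
  by rewrite mulr_ge0// addr_ge0 ?ler0n.
elim: i => [|i [Ws [sW aW HW]]].
  elim: j => [|j [Ws [sW aW HW]]].
    by exists [::]; split => //= x; rewrite powR0// gt_eqF.
  have [Q bQ HQ] := boost_visits (v0 j) HW.
  by exists (Q :: Ws); split => //=; rewrite sW.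
have i0 x : 0 <= iter i (avg K) (visits (nseq j K) U) x.
  elim: i x {aW HW sW} => //= i IH x; apply: sumr_ge0 => y _.
  by rewrite mulr_ge0.
have [Q bQ HQ] := boost_visits i0 HW.
exists (Q :: Ws); split => //=; first by rewrite sW.
move=> x; apply: le_trans (HQ x); apply: ge0_ler_powR; rewrite ?nnegrE ?(ltW p_gt0)//.
- by apply: sumr_ge0 => y _; rewrite mulr_ge0.
- by apply: sumr_ge0 => y _; rewrite mulr_ge0// addr_ge0 ?ler0n.
by apply: avg_le => // y; rewrite lerDr ler0n.
Qed.
End Boost.

(** * A round of exploration *)

Section Explore.
Context (R : realType) (V : finType) (K : V -> V -> R) (rho eta kap : R).
Hypothesis K_ge0 : forall x y, 0 <= K x y.
Hypothesis K_sum : forall x, \sum_y K x y = 1.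
Hypothesis K_sym : forall x y, K x y = K y x.
Hypothesis K_contr : forall f : V -> R, \sum_x f x = 0 ->
  \sum_x avg K f x ^+ 2 <= rho ^+ 2 * \sum_x f x ^+ 2.
Hypothesis V_gt0 : (0 < #|V|)%N.
Hypothesis eta_ge0 : 0 <= eta.
Hypothesis eta_lt1 : eta < 1.
Hypothesis kap_ge0 : 0 <= kap.
Hypothesis K_kap : forall x y, 0 < K x y -> 1 <= kap * K x y.
Local Notation n := (#|V|%:R : R).
Local Notation p := (1 - eta).
Local Notation alpha := (1 + kap * eta).
Implicit Types (Q : V -> V -> R) (f g h : V -> R) (Qs : seq (V -> V -> R)) (U : {set V}).

Let n0 : 0 < n. Proof. exact: n_gt0. Qed.
Let p_gt0 : 0 < p. Proof. by rewrite subr_gt0. Qed.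
Let p_le1 : p <= 1. Proof. by rewrite gerBl. Qed.
Let alpha_ge1 : 1 <= alpha. Proof. by rewrite lerDl mulr_ge0. Qed.

(** A second moment bound shows that [f] is comparable with its mean on a
    positive proportion of the vertices, whence the mean of [f `^ p] is
    comparable with [a `^ p]. *)
Lemma powR_moments f (a : R) : 0 < a -> (forall x, 0 <= f x) ->
  mean f = a -> var f <= n * a ^+ 2 ->
  a `^ p / 2 <= mean (fun x => f x `^ p) /\
  \sum_x (f x `^ p) ^+ 2 <= 3 * n * (a `^ p) ^+ 2.
Proof.
move=> a0 f0 mf vf; pose t x := f x / a.
have t0 x : 0 <= t x by rewrite divr_ge0// ltW.
have ft x : f x = a * t x by rewrite /t mulrCA divff ?mulr1// gt_eqF.
have gE x : f x `^ p = a `^ p * t x `^ p by rewrite ft powRM// ltW.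
have mt : mean t = 1.
  have an0 : a != 0 by rewrite gt_eqF.
  apply: (mulfI an0).
  by rewrite -meanZ mulr1 -[RHS]mf; apply: eq_mean => x; rewrite -ft.
have st : \sum_x t x ^+ 2 <= 2 * n.
  have a2 : 0 < a ^+ 2 by rewrite exprn_gt0.
  rewrite -(ler_pM2l a2) mulr_sumr.
  have -> : \sum_x a ^+ 2 * t x ^+ 2 = \sum_x (f x - 0) ^+ 2.
    by apply: eq_bigr => x _; rewrite subr0 [in RHS]ft [RHS]exprMn.
  rewrite sum_sqr_dev// mf subr0.
  have -> : a ^+ 2 * (2 * n) = n * a ^+ 2 + n * a ^+ 2 by ring.
  by rewrite lerD2r.
have q0 := powR_ge0 a p.
split.
  rewrite (eq_mean gE) meanZ ler_wpM2l//.
  apply: le_trans (mean_le V_gt0 (fun x => powR_ge_parabola p_gt0 p_le1 (t0 x))).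
  have -> : mean (fun x => t x - t x ^+ 2 / 4) = mean t + mean (fun x => (- 4^-1) * t x ^+ 2).
    by rewrite -meanD; apply: eq_mean => x; ring.
  rewrite meanZ mt.
  have : mean (fun x => t x ^+ 2) <= 2 by rewrite /mean ler_pdivrMr.
  lra.
rewrite (eq_bigr (fun x => (a `^ p) ^+ 2 * (t x `^ p) ^+ 2)); last first.
  by move=> x _; rewrite gE exprMn.
rewrite -mulr_sumr mulrC ler_wpM2r ?sqr_ge0//.
apply: le_trans (_ : \sum_x (1 + t x ^+ 2) <= _).
  by apply: ler_sum => x _; rewrite powR_sqr_le.
have -> : 3 * n = n + 2 * n by ring.
rewrite big_split /= lerD//; have -> : \sum_(x : V) (1 : R) = n by rewrite sumr_const.
exact: lexx.
Qed.

Lemma sum_visits_nseq L U : \sum_x visits (nseq L K) U x = L%:R * #|U|%:R.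
Proof.
elim: L => [|L IH] /=; first by rewrite mul0r big1.
have := mean_avg K_sum K_sym (fun y => (y \in U)%:R + visits (nseq L K) U y).
move=> /(congr1 ( *%R n)); rewrite -!sum_mean// => ->.
rewrite big_split /= IH -natr1 mulrDl mul1r addrC; congr (_ + _).
by rewrite -sum1_card natr_sum [RHS]big_mkcond; apply: eq_bigr => x _; case: (_ \in _).
Qed.

Lemma visits_nseq_le L U x : 0 <= visits (nseq L K) U x <= L%:R.
Proof.
elim: L x => [|L IH] x /=; first by rewrite lexx.
apply/andP; split.
  apply: sumr_ge0 => y _; rewrite mulr_ge0// addr_ge0 ?ler0n//.
  by have /andP[] := IH y.
rewrite -[leRHS]mul1r -[X in _ <= X * _](K_sum x) mulr_suml; apply: ler_sum => y _.
rewrite ler_wpM2l// -natr1 addrC lerD//; last by case: (_ \in _).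
by have /andP[] := IH y.
Qed.

(** A block is [L] unbiased steps followed by the window [W], from which [x]
    yields [g x] visits.  The law of the walk at the start of a window should be
    nearly uniform, although the bias of the previous windows has distorted
    it.  Dually: [G], the number of visits collected by the remaining
    blocks, has bounded variance, since a window expands the variance at most by
    [alpha ^+ (L + L)] and the following [L] unbiased steps contract it by
    [(rho ^+ 2) ^+ L].  Therefore each block adds [3 / 4 * mean g] to the mean of
    [G], instead of [mean g]. *)
Lemma visits_blocks U W L g r :
  all_kernels (tame K alpha) W -> size W = (L + L)%N ->
  (forall x, 0 <= g x) -> (forall x, g x <= visits W U x) ->
  \sum_x g x ^+ 2 <= 16 * n * mean g ^+ 2 ->
  (alpha ^+ 2 * rho ^+ 2) ^+ L <= 1024^-1 ->
  exists G, [/\ forall x, G x <= visits (flatten (nseq r (nseq L K ++ W))) U x,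
    var G <= 64 * n * mean g ^+ 2 &
    3 / 4 * r%:R * mean g <= mean G].
Proof.
move=> tW sW g0 gW g2 Hb; set gb := mean g in g2 *.
have gb0 : 0 <= gb by rewrite /gb /mean divr_ge0// ?sumr_ge0// ltW.
set s2 := \sum_x g x ^+ 2 in g2 *.
have s20 : 0 <= s2 by apply: sumr_ge0 => x _; rewrite sqr_ge0.
set q := (rho ^+ 2) ^+ L; set a := alpha ^+ (L + L).
have q0 : 0 <= q by rewrite exprn_ge0// sqr_ge0.
have a0 : 1 <= a by rewrite exprn_ege1.
have aq : a * q <= 1024^-1.
  by rewrite /a /q addnn -mul2n exprM -exprMn.
have q1 : q <= 1 by nra.
have tK : all_kernels (tame K alpha) (nseq L K).
  by elim: L {Hb q a q0 a0 aq q1 sW} => //= L IH; split => //; exact: tame_refl.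
suff [G [HG vG mG]] : exists G,
    [/\ forall x, G x <= visits (flatten (nseq r (nseq L K ++ W))) U x,
    var G <= 4 * q * s2 & 3 / 4 * r%:R * gb <= mean G].
  exists G; split => //; rewrite (le_trans vG)//; have h : q * s2 <= s2 by rewrite ler_piMl.
  lra.
elim: r => [|r [G [HG vG mG]]] /=.
  exists (fun=> 0); split=> //; last by rewrite mean_cst// mulr0 mul0r.
  rewrite /var mean_cst// big1 ?mulr_ge0// => x _.
  by rewrite subr0 expr0n.
set m := mean G in mG *.
set WG := run W G.
pose h x := g x + WG x.
have devW : \sum_x (WG x - m) ^+ 2 <= a * var G.
  by have := run_sqr_dev K_sum K_sym G m (le_trans ler01 alpha_ge1) tW; rewrite sW.
exists (iter L (avg K) h); split.
- move=> x; rewrite -catA visits_cat.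
  apply: le_trans (_ : run (nseq L K) (visits (W ++ flatten (nseq r (nseq L K ++ W))) U) x <= _).
    rewrite -run_nseq; apply: (run_le tK) => y.
    rewrite visits_cat lerD//; exact: (run_le tW).
  by rewrite lerDr (visits_ge0 _ _ tK).
- rewrite (le_trans (var_iter K_sum K_sym K_contr V_gt0 L h))// -/q.
  have -> : 4 * q * s2 = q * (4 * s2) by ring.
  rewrite ler_wpM2l//.
  apply: le_trans (var_le V_gt0 h m) _.
  apply: le_trans (_ : 2 * s2 + 2 * \sum_x (WG x - m) ^+ 2 <= _).
    rewrite !mulr_sumr -big_split /=; apply: ler_sum => x _; rewrite /h.
    have := sqr_ge0 (g x - (WG x - m)); nra.
  have : a * var G <= a * (4 * q * s2) by rewrite ler_wpM2l// (le_trans ler01).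
  nra.
- rewrite mean_iter// meanD -/gb.
  (* The root of [1024^-1] is [1 / 32], and [8 / 32 = 1 / 4] is the fraction of
     [gb] that is lost. *)
  have : n * (mean WG - m) ^+ 2 <= n * (gb / 4) ^+ 2.
    rewrite (le_trans (mean_dev V_gt0 WG m))// (le_trans devW)//.
    apply: le_trans (_ : a * (4 * q * (16 * n * gb ^+ 2)) <= _).
      rewrite ler_wpM2l// ?(le_trans ler01)// (le_trans vG)//.
      by rewrite ler_wpM2l// mulr_ge0.
    have -> : a * (4 * q * (16 * n * gb ^+ 2)) = (a * q) * (64 * n * gb ^+ 2) by ring.
    have -> : n * (gb / 4) ^+ 2 = 1024^-1 * (64 * n * gb ^+ 2) by field.
    by rewrite ler_wpM2r// mulr_ge0 ?sqr_ge0// mulr_ge0// ltW.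
  rewrite ler_pM2l// => /norm_le_sqr; rewrite divr_ge0// => /(_ isT).
  rewrite ler_norml => /andP[h1 _]; move: mG; rewrite -natr1; nra.
Qed.

Definition allowed Q : Prop := Q = K \/ boosted K eta Q.

Lemma tame_allowed Q : allowed Q -> tame K alpha Q.
Proof.
by case=> [->|[b Hb ->]]; [exact: tame_refl | exact: tame_biased].
Qed.

Lemma sub_all_kernels (P1 P2 : (V -> V -> R) -> Prop) Qs :
  (forall Q, P1 Q -> P2 Q) -> all_kernels P1 Qs -> all_kernels P2 Qs.
Proof. by move=> H; elim: Qs => //= Q Qs IH [/H ? /IH]. Qed.

(** From an arbitrary start, [M] unbiased steps reach near-uniformity at a cost
    of order [log n]; they are followed by [r] blocks of total length comparable
    with [M], so that this cost is amortised over many windows.  The windows can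
    then have a length [L] of order [log (n / #|U|)] only. *)
Lemma exploration_round U L r M : (0 < #|U|)%N -> (0 < L)%N -> (0 < r)%N ->
  (rho ^+ 2) ^+ L <= #|U|%:R / n ->
  (alpha ^+ 2 * rho ^+ 2) ^+ L <= 1024^-1 ->
  1024 * n * (rho ^+ 2) ^+ M <= 1 ->
  exists Qs, [/\ size Qs = (M + r * (L + (L + L)))%N, all_kernels allowed Qs &
    forall x, r%:R * (L%:R * (#|U|%:R / n)) `^ p / 4 <= visits Qs U x].
Proof.
move=> U0 L0 r0 HL Hb HM.
have [W [sW bW HW]] := @boosted_window _ _ K eta K_ge0 K_sum eta_ge0 eta_lt1 U L L.
have aW : all_kernels allowed W by apply: sub_all_kernels bW => Q; right.
have tW : all_kernels (tame K alpha) W by apply: sub_all_kernels aW; exact: tame_allowed.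
pose H := iter L (avg K) (visits (nseq L K) U).
pose a : R := L%:R * (#|U|%:R / n).
have u0 : 0 < #|U|%:R :> R by rewrite ltr0n.
have l0 : 0 < L%:R :> R by rewrite ltr0n.
have a0 : 0 < a by rewrite mulr_gt0// divr_gt0.
have H0 x : 0 <= H x.
  rewrite /H; elim: (X in iter X) x => [|i IH] x /=.
    by have /andP[] := visits_nseq_le L U x.
  by apply: sumr_ge0 => y _; rewrite mulr_ge0.
have mH : mean H = a.
  by rewrite /H mean_iter// /mean sum_visits_nseq /a mulrA.
have vH : var H <= n * a ^+ 2.
  apply: le_trans (var_iter K_sum K_sym K_contr V_gt0 _ _) _.
  apply: le_trans (_ : #|U|%:R / n * (L%:R * (L%:R * #|U|%:R)) <= _).
    apply: ler_pM; rewrite 1?exprn_ge0 ?sqr_ge0 ?var_ge0//.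
    rewrite (le_trans (var_le V_gt0 _ 0))// -sum_visits_nseq mulr_sumr.
    apply: ler_sum => x _; rewrite subr0 expr2; have /andP[? ?] := visits_nseq_le L U x.
    by rewrite ler_wpM2r.
  have -> // : #|U|%:R / n * (L%:R * (L%:R * #|U|%:R)) = n * a ^+ 2.
  by rewrite /a; field; rewrite gt_eqF.
have [m1 m2] := powR_moments a0 H0 mH vH.
pose g x := H x `^ p; set gb := mean g in m1.
have q0 : 0 <= a `^ p := powR_ge0 _ _.
have [G [HG vG mG]] : exists G,
  [/\ forall x, G x <= visits (flatten (nseq r (nseq L K ++ W))) U x,
    var G <= 64 * n * gb ^+ 2 &
    3 / 4 * r%:R * gb <= mean G].
  apply: visits_blocks => //; first by move=> x; exact: powR_ge0.
  rewrite -/gb (le_trans m2)// mulrAC [leRHS]mulrAC ler_wpM2r ?(ltW n0)//.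
  by rewrite -!/(n); nra.
have aK j : all_kernels allowed (nseq j K) by elim: j => //= j IH; split => //; left.
have tK j : all_kernels (tame K alpha) (nseq j K).
  by apply: sub_all_kernels (aK j); exact: tame_allowed.
exists (nseq M K ++ flatten (nseq r (nseq L K ++ W))); split.
- rewrite size_cat size_nseq size_flatten /shape map_nseq sumn_nseq.
  by rewrite size_cat size_nseq sW mulnC.
- apply/all_kernels_cat; split => //.
  elim: r {r0 HG mG} => //= r IH; apply/all_kernels_cat; split => //.
  by apply/all_kernels_cat.
- move=> x; rewrite visits_cat.
  have gb0 : 0 <= gb by lra.
  have h1 : mean G - gb / 4 <= iter M (avg K) G x.
    apply: (iter_ge K_sum K_sym K_contr V_gt0); first by rewrite divr_ge0.
    apply: le_trans (_ : (rho ^+ 2) ^+ M * (64 * n * gb ^+ 2) <= _).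
      by rewrite ler_wpM2l// exprn_ge0// sqr_ge0.
    have gb2 := sqr_ge0 gb; nra.
  have h2 : iter M (avg K) G x <= run (nseq M K) (visits (flatten (nseq r (nseq L K ++ W))) U) x.
    by rewrite -run_nseq; apply: (run_le (tK M)).
  have h3 := visits_ge0 U x (tK M).
  have r1 : 1 <= r%:R :> R by rewrite ler1n.
  rewrite -/a; nra.
Qed.

End Explore.

(** * Numerical estimates *)

Section Numerics.
Context (R : realType).
Implicit Types (x y t q g eps eta rho alpha : R) (n m k d L r N : nat).

Lemma expR_pow_ge k x : k%:R <= x -> 2 ^+ k <= expR x.
Proof.
move=> kx; apply: le_trans (_ : expR k%:R <= _); last by rewrite ler_expR.
rewrite -[k%:R]mulr1 expRM_natl lerXn2r ?nnegrE ?expR_ge0//.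
by have := expR_ge1Dx (1 : R); lra.
Qed.

Lemma exp_decay x (L : nat) : 0 <= x -> x <= 1 -> (1 - x) ^+ L <= expR (- (L%:R * x)).
Proof.
move=> x0 x1; rewrite -mulrN expRM_natl lerXn2r ?nnegrE ?expR_ge0 ?subr_ge0//.
by have := expR_ge1Dx (- x); lra.
Qed.

Lemma exists_nat_ceil x : 0 < x -> exists2 L, (0 < L)%N & x <= L%:R <= x + 1.
Proof.
move=> x0; exists (Num.truncn x).+1 => //.
have /andP[h1 h2] := truncn_itv (ltW x0).
by rewrite (ltW h2) -natr1 lerD2r.
Qed.

Lemma ln_ge_half k n : (2 ^ k <= n)%N -> k%:R / 2 <= ln (n%:R : R).
Proof.
move=> kn; have n0 : (0 < n)%N by rewrite (leq_trans _ kn)// expn_gt0.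
have : ln ((2 ^ k)%:R : R) <= ln n%:R.
  by rewrite ler_ln ?posrE ?ltr0n ?expn_gt0// ler_nat.
rewrite natrX lnXn//; apply: le_trans; rewrite -[leRHS]mulr_natl ler_wpM2l//.
have := le_ln1Dx (_ : -1 < - 2^-1 :> R); rewrite (_ : 1 + - 2^-1 = 2^-1 :> R); last by lra.
by rewrite lnV ?posrE//; lra.
Qed.

Lemma one_sub_inv x : 0 <= x -> 1 + - (x + 1)^-1 = x / (x + 1).
Proof. by move=> x0; field; apply: lt0r_neq0; lra. Qed.

Lemma sum_inv_le n : (0 < n)%N -> \sum_(k < n) (k.+1%:R : R)^-1 <= 1 + ln n%:R.
Proof.
case: n => // n _; elim: n => [|n IH].
  by rewrite big_ord_recl big_ord0 ln1 invr1.
rewrite big_ord_recr /= (le_trans (lerD IH (lexx _)))// -addrA lerD2l.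
have := le_ln1Dx (_ : -1 < - (n.+2%:R)^-1 :> R).
have -> : 1 + - (n.+2%:R)^-1 = n.+1%:R / n.+2%:R :> R.
  by rewrite -[n.+2%:R]natr1 one_sub_inv.
rewrite ln_div ?posrE// => H.
have : ln n.+1%:R - ln n.+2%:R <= - n.+2%:R^-1 :> R.
  by apply: H; rewrite ltrN2 invf_lt1// ltr1n.
by rewrite lerBlDl lerBrDr.
Qed.

(** Integral comparison, in the form
    [k `^ q + q * (k.+1) `^ (q - 1) <= k.+1 `^ q]. *)
Lemma sum_powR_le q n : 0 < q -> q <= 1 ->
  \sum_(k < n) (k.+1%:R : R) `^ (q - 1) <= n%:R `^ q / q.
Proof.
move=> q0 q1; elim: n => [|n IH].
  by rewrite big_ord0 divr_ge0 ?powR_ge0// ltW.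
rewrite big_ord_recr /= (le_trans (lerD IH (lexx _)))//.
rewrite ler_pdivlMr// mulrDl divfK ?gt_eqF//.
have t0 : 0 <= n%:R / n.+1%:R :> R by rewrite divr_ge0.
have H := @powR_le_affine R (1 - q) _ _ _ t0.
have {}H : (n%:R / n.+1%:R) `^ q <= q * (n%:R / n.+1%:R) + (1 - q).
  by move: H; rewrite opprB addrCA subrr addr0; apply; lra.
have N0 : 0 < n.+1%:R :> R by rewrite ltr0n.
have -> : n%:R `^ q = n.+1%:R `^ q * (n%:R / n.+1%:R) `^ q :> R.
  by rewrite -powRM// mulrCA divff ?mulr1// gt_eqF.
have -> : n.+1%:R `^ (q - 1) = n.+1%:R `^ q * n.+1%:R^-1 :> R.
  rewrite powRD; last by apply/implyP => _; rewrite gt_eqF.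
  by rewrite powR_inv1// ltW.
rewrite -mulrA -mulrDr ler_piMr ?powR_ge0//.
apply: le_trans (lerD H (lexx _)) _.
rewrite -[n.+1%:R]natr1 -(one_sub_inv (ler0n _ n)).
lra.
Qed.

Lemma powR_sum_le_ln q n : (0 < n)%N -> 0 <= q -> q <= 1 ->
  \sum_(k < n) (n%:R / k.+1%:R : R) `^ (1 - q) <= n%:R * (1 + ln n%:R).
Proof.
move=> n0 q0 q1; apply: le_trans (ler_wpM2l _ (sum_inv_le n0)); last exact: ler0n.
rewrite mulr_sumr; apply: ler_sum => k _.
have h : 1 <= n%:R / k.+1%:R :> R by rewrite ler_pdivlMr// mul1r ler_nat.
by rewrite ler1_powR// gerBl.
Qed.

Lemma powR_sum_le_inv q n : (0 < n)%N -> 0 < q -> q <= 1 ->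
  \sum_(k < n) (n%:R / k.+1%:R : R) `^ (1 - q) <= n%:R / q.
Proof.
move=> n0 q0 q1; have N0 : 0 < n%:R :> R by rewrite ltr0n.
apply: le_trans (_ : n%:R `^ (1 - q) * (n%:R `^ q / q) <= _); last first.
  rewrite mulrA -powRD; last by apply/implyP => _; rewrite gt_eqF.
  by rewrite subrK powRr1// ltW.
apply: le_trans (ler_wpM2l (powR_ge0 _ _) (sum_powR_le n q0 q1)).
rewrite mulr_sumr; apply: ler_sum => k _.
rewrite powRM ?invr_ge0// -powR_inv1// -powRrM mulN1r opprB.
exact: lexx.
Qed.

Lemma expR10_ge : 1024 <= expR (10 : R).
Proof.
apply: le_trans (@expR_pow_ge 10 10 (lexx _)).
by rewrite !exprS expr0; lra.
Qed.

Lemma expRN10_le : expR (- 10 : R) <= 1024^-1.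
Proof.
have h : 0 < 1024 :> R by rewrite ltr0n.
move: h expR10_ge; move: (1024 : R) => c c0 h.
by rewrite expRN lef_pV2 ?posrE ?expR_gt0.
Qed.

Lemma mul_expRN10_le x : 1024 * expR x * expR (- (x + 10)) <= 1.
Proof.
move: expR10_ge; move: (1024 : R) => c h.
rewrite opprD expRD mulrA -[c * _ * _]mulrA -expRD subrr expR0 mulr1 expRN.
by rewrite ler_pdivrMr ?expR_gt0// mul1r.
Qed.

(** With [t = n / m], [L] is about [(20 + ln t) / g], long enough to mix down to
    the density [1 / t] of the target, and [r] is the number of blocks making
    [r * L] about [(ln n + 10) / g], the mixing time from a point.  The total
    length is [4 * r * L = O(ln n / g)], so that [alpha], which exceeds 1 by at
    most [g / 64], gives [alpha ^+ N <= n `^ (1 / 4)], and returns after mixing are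
    negligible once [n] is large.  In the last clause the factor [L `^ eta] is
    bounded by [(22 / g) * t `^ (eta / 2)]: this is why the exponent of [t] is
    [1 - eta / 2] rather than [1 - eta]. *)
Lemma round_parameters n m g eps eta (rho := 1 - g / 2) (alpha := 1 + 2 * eps) :
  0 < g -> g <= 2 -> 0 <= eps -> eps <= g / 128 -> 0 <= eta -> eta <= 1 ->
  128 <= ln (n%:R : R) -> (0 < m)%N -> (m <= n)%N ->
  exists L r M : nat,
  [/\ [/\ (0 < L)%N, (0 < r)%N & (rho ^+ 2) ^+ L <= m%:R / n%:R],
      (alpha ^+ 2 * rho ^+ 2) ^+ L <= 1024^-1,
      1024 * n%:R * (rho ^+ 2) ^+ M <= 1,
      (g / 4)^-1 + (M + r * (L + (L + L)))%:R * alpha ^+ (M + r * (L + (L + L))) / n%:R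
        <= 5 / g &
      (M + r * (L + (L + L)))%:R * (1 + 5 / g) <
        (4000 / g ^+ 2) * (n%:R / m%:R) `^ (1 - eta / 2) *
        (r%:R * (L%:R * (m%:R / n%:R)) `^ (1 - eta) / 4)].
Proof.
move=> g0 g2 e0 e1 eta0 eta1 ln128 m0 mn.
have n0 : (0 < n)%N by exact: leq_trans mn.
have N0 : 0 < n%:R :> R by rewrite ltr0n.
have M0 : 0 < m%:R :> R by rewrite ltr0n.
set l := ln (n%:R : R) in ln128 *.
have nE : n%:R = expR l by rewrite /l lnK.
pose y := l - ln (m%:R : R).
have mnE : m%:R / n%:R = expR (- y).
  by rewrite nE /y opprB expRB lnK.
have nmE : n%:R / m%:R = expR y by rewrite /y expRB lnK// -nE.
have y0 : 0 <= y by rewrite /y subr_ge0 ler_ln ?posrE// ler_nat.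
have yl : y <= l by rewrite /y gerBl ln_ge0// ler1n.
have [L L0 /andP[L1 L2]] := @exists_nat_ceil ((20 + y) / g) ltac:(by rewrite divr_gt0//; lra).
have gL1 : 20 + y <= g * L%:R by rewrite -ler_pdivrMl// mulrC.
have gL2 : g * L%:R <= 22 + y.
  apply: le_trans (_ : g * ((20 + y) / g + 1) <= _); first by rewrite ler_pM2l.
  by rewrite mulrDr mulrC divfK ?gt_eqF//; lra.
have RL0 : 0 < L%:R :> R by rewrite ltr0n.
have gL0 : 0 < g * L%:R by rewrite mulr_gt0.
have [r r0 /andP[r1 r2]] := @exists_nat_ceil ((l + 10) / (g * L%:R)) ltac:(by rewrite divr_gt0//; lra).
have gr1 : l + 10 <= g * L%:R * r%:R by rewrite -ler_pdivrMl// mulrC.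
have gr2 : g * L%:R * r%:R <= l + 10 + g * L%:R.
  apply: le_trans (_ : g * L%:R * ((l + 10) / (g * L%:R) + 1) <= _); first by rewrite ler_pM2l.
  by rewrite mulrDr [g * L%:R * (_ / _)]mulrC divfK ?gt_eqF//; lra.
have Rr0 : 0 < r%:R :> R by rewrite ltr0n.
have rho0 : 0 <= rho by rewrite /rho; lra.
have decay k : (rho ^+ 2) ^+ k <= expR (- (g * k%:R)).
  rewrite -exprM (le_trans (exp_decay _ _ _))//; [lra|lra|].
  rewrite ler_expR lerN2 natrM; lra.
exists L, r, (r * L)%N.
set N := (r * L + r * (L + (L + L)))%N.
have NE : N%:R = 4 * r%:R * L%:R :> R.
  by rewrite /N !natrD !natrM !natrD; ring.
have gN : g * N%:R <= 16 * l.
  have -> : g * N%:R = 4 * (g * L%:R * r%:R) by rewrite NE; ring.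
  lra.
have a1 : alpha <= 1 + g / 64 by rewrite /alpha; lra.
have ar : alpha * rho <= 1 - g / 4.
  apply: le_trans (_ : (1 + g / 64) * rho <= _); first by rewrite ler_wpM2r.
  by rewrite /rho; nra.
have a0 : 1 <= alpha by rewrite /alpha; lra.
split.
- split => //; rewrite mnE (le_trans (decay L))// ler_expR lerN2; lra.
- rewrite -exprMn -exprM.
  apply: le_trans (_ : (1 - g / 4) ^+ (2 * L) <= _).
    by rewrite lerXn2r ?nnegrE ?mulr_ge0//; lra.
  rewrite (le_trans (exp_decay _ _ _))//; [lra|lra|].
  apply: le_trans (_ : expR (- 10) <= _).
    by rewrite ler_expR lerN2 natrM; lra.
  exact: expRN10_le.
- apply: le_trans (_ : 1024 * n%:R * expR (- (l + 10)) <= _).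
    apply: ler_wpM2l; first by apply: mulr_ge0; exact: ler0n.
    rewrite (le_trans (decay _))// ler_expR lerN2 natrM.
    by rewrite [r%:R * _]mulrC mulrA.
  rewrite nE; exact: mul_expRN10_le.
- have aN : alpha ^+ N <= expR (l / 4).
    apply: le_trans (_ : expR (2 * eps) ^+ N <= _).
      by rewrite lerXn2r ?nnegrE ?expR_ge0 ?(le_trans ler01)// expR_ge1Dx.
    rewrite -expRM_natl ler_expR.
    have Ng : N%:R * (2 * eps) <= N%:R * (g / 64) by rewrite ler_wpM2l//; lra.
    lra.
  have -> : (g / 4)^-1 = 4 / g by rewrite invf_div.
  have -> : 5 / g = 4 / g + g^-1 by field; rewrite gt_eqF.
  rewrite lerD2l ler_pdivrMr//.
  rewrite -(ler_pM2l g0) mulrA mulrA mulfV ?gt_eqF// mul1r.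
  apply: le_trans (_ : 16 * l * expR (l / 4) <= _).
    apply: ler_pM => //; first by rewrite mulr_ge0// ltW.
    by rewrite exprn_ge0// (le_trans ler01).
  have -> : n%:R = expR (3 * l / 4) * expR (l / 4) by rewrite nE -expRD; congr expR; field.
  rewrite ler_pM2r ?expR_gt0//.
  have -> : expR (3 * l / 4) = expR (3 * l / 8) ^+ 2.
    by rewrite -expRM_natl; congr expR; field.
  apply: le_trans (_ : (1 + 3 * l / 8) ^+ 2 <= _); first by nra.
  by rewrite lerXn2r ?nnegrE ?expR_ge0 ?expR_ge1Dx//; lra.
- rewrite nmE mnE NE -expRM.
  have -> : (L%:R * expR (- y)) `^ (1 - eta) = L%:R `^ (1 - eta) * expR (- y * (1 - eta)).
    by rewrite powRM ?expR_ge0// expRM.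
  set P := L%:R `^ (1 - eta).
  have P0 : 0 < P by exact: powR_gt0.
  pose E := expR (y * eta / 2).
  have E0 : 0 < E by exact: expR_gt0.
  (* With [L <= P * (22 / g * E)], both sides become multiples of
     [r * P * E / g ^+ 2], with factors [28 * 22] and [4000 / 4]. *)
  have LE : L%:R <= P * (22 / g * E).
    have {1}-> : L%:R = P * L%:R `^ eta.
      rewrite /P -powRD ?subrK ?powRr1//.
      by apply/implyP => _; rewrite gt_eqF.
    rewrite ler_wpM2l ?(ltW P0)//.
    have h1 : L%:R <= 22 / g * expR (y / 2).
      rewrite mulrAC ler_pdivlMr// mulrC (le_trans gL2)//.
      have := expR_ge1Dx (y / 2); lra.
    have h2 : 1 <= 22 / g by rewrite ler_pdivlMr//; lra.
    apply: le_trans (_ : (22 / g * expR (y / 2)) `^ eta <= _).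
      by rewrite ge0_ler_powR// nnegrE// mulr_ge0 ?expR_ge0//; lra.
    rewrite powRM ?expR_ge0//; last by lra.
    rewrite -expRM /E [y * eta / 2]mulrAC ler_wpM2r ?expR_ge0//.
    by rewrite ler1_powR.
  have -> : 4000 / g ^+ 2 * expR (y * (1 - eta / 2)) *
      (r%:R * (P * expR (- y * (1 - eta))) / 4) = 1000 / g ^+ 2 * r%:R * (P * E).
    have -> : E = expR (y * (1 - eta / 2)) * expR (- y * (1 - eta)).
      by rewrite -expRD; congr expR; field.
    by field; rewrite gt_eqF.
  apply: le_lt_trans (_ : 28 / g * r%:R * L%:R < _).
    have -> : 4 * r%:R * L%:R * (1 + 5 / g) = (4 * (1 + 5 / g)) * (r%:R * L%:R) by ring.
    rewrite -[leRHS]mulrA ler_wpM2r ?mulr_ge0//.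
    have : 1 <= 2 / g by rewrite ler_pdivlMr//; lra.
    lra.
  apply: le_lt_trans (_ : 28 / g * r%:R * (P * (22 / g * E)) < _).
    by rewrite ler_wpM2l// mulr_ge0// divr_ge0// ltW.
  have -> : 28 / g * r%:R * (P * (22 / g * E)) = 616 / g ^+ 2 * r%:R * (P * E).
    by field; rewrite gt_eqF.
  rewrite ltr_pM2r ?mulr_gt0// ltr_pM2r// ltr_pM2r ?invr_gt0 ?exprn_gt0//.
  by clear; lra.
Qed.

(** Since [g <= 2], the exponent [100 / g] exceeds 1 with enough to spare to
    absorb [g ^- 2]. *)
Lemma final_constant d g : (1 < d)%N -> 0 < g -> g <= 2 ->
  16000 * d%:R / g ^+ 2 <= 10 ^+ 10 * d%:R `^ (100 / g).
Proof.
move=> d1 g0 g2; pose w := g^-1; have w0 : 1 / 2 <= w.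
  by rewrite /w ler_pdivrMr// mulrC ler_pdivlMr// mul1r.
have d0 : 0 < d%:R :> R by rewrite ltr0n (ltn_trans _ d1).
have ld : 1 / 2 <= ln (d%:R : R).
  by have := @ln_ge_half 1 d; rewrite expn1; exact.
have -> : 100 / g = 1 + (100 * w - 1) by rewrite addrCA subrr addr0.
rewrite powRD; last by apply/implyP => _; rewrite gt_eqF.
rewrite powRr1 ?ler0n//.
have : w ^+ 2 <= d%:R `^ (100 * w - 1).
  rewrite /powR gt_eqF//.
  apply: le_trans (_ : expR (2 * w) <= _).
    have -> : expR (2 * w) = expR w ^+ 2 by rewrite -expRM_natl.
    by rewrite lerXn2r ?nnegrE ?expR_ge0//; have := expR_ge1Dx w; lra.
  by rewrite ler_expR; nra.
have -> : 16000 * d%:R / g ^+ 2 = 16000 * d%:R * w ^+ 2 by rewrite exprVn.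
have h0 : 0 <= w ^+ 2 := sqr_ge0 _.
have h10 : 16000 <= 10 ^+ 10 :> R.
  apply: le_trans (_ : 10 ^+ 5 <= _); last by rewrite ler_weXn2l//; lra.
  by rewrite !exprS expr0; lra.
have k0 : 0 <= 16000 :> R by exact: ler0n.
move: k0 h0 h10; move: (16000 : R) (10 ^+ 10) (w ^+ 2) (d%:R `^ (100 * w - 1)).
move=> k c u v k0 u0 h10 uv; rewrite -mulrA.
by apply: ler_pM; rewrite ?mulr_ge0 ?(ltW d0)// ler_pM2l.
Qed.

End Numerics.

(** * Bound on subsolutions of the optimality equation *)

(** [f x U] stands for an expected remaining cover time from [x] when the
    vertices of [U] are still to be visited.  An inequality for each possible
    choice [b] of the controller means that [f] is at most the cost of any
    strategy. *)
Record subsolution (R : realType) (V : finType) (e : rel V) (eps : R)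
    (f : V -> {set V} -> R) : Prop := Subsolution {
  subsol0 : forall x, f x finset.set0 = 0 ;
  subsol_step : forall x b (U : {set V}), x \notin U -> U != finset.set0 -> e x b ->
    f x U <= 1 + (1 - eps) * avg (srw R e) (fun y => f y (U :\ y)) x
               + eps * f b (U :\ b) }.

(** Comparison of [f] with a function of the number of unvisited vertices: the
    largest excess of [f] over [F] cannot be positive if it strictly decreases
    over one round. *)
Lemma maximum_principle (R : realType) (V : finType) (f : V -> {set V} -> R) (F : nat -> R) :
  (forall x, f x finset.set0 = 0) -> F 0%N = 0 ->
  (forall (U : {set V}) (c : R), U != finset.set0 -> 0 <= c ->
     (forall x (W : {set V}), x \notin W -> (#|W| <= #|U|)%N -> f x W <= F #|W| + c) ->
     forall x, x \notin U -> f x U < F #|U| + c) ->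
  forall x (U : {set V}), x \notin U -> f x U <= F #|U|.
Proof.
move=> f0 F0 improve x U xU; rewrite leNgt; apply/negP => bad.
pose h (z : V * {set V}) := f z.1 z.2 - F #|z.2|.
pose z := [arg max_(w > (x, U) | w.1 \notin w.2) h w]%O.
have [zP hz] : z.1 \notin z.2 /\ forall w : V * {set V}, w.1 \notin w.2 -> h w <= h z.
  by rewrite /z; case: Order.TotalTheory.arg_maxP.
have hz0 : 0 < h z by apply: lt_le_trans (hz (x, U) xU); rewrite /h subr_gt0.
have zU : z.2 != finset.set0.
  apply/eqP => z2; move: hz0; rewrite /h z2 f0 cards0 F0 subrr ltxx; exact.
have := improve z.2 (h z) zU (ltW hz0) _ z.1 zP.
rewrite {2}/h subrKC ltxx => H; apply: notF; apply: H => y W yW _.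
by have := hz (y, W) yW; rewrite {1}/h /= lerBlDl.
Qed.

Section Graph.
Context (R : realType) (V : finType) (e : rel V) (d : nat) (eps eta : R).
Hypothesis simple_e : simple_graph e.
Hypothesis conn_e : connected_graph e.
Hypothesis reg_e : regular_graph e d.
Hypothesis card_gt2 : (2 < #|V|)%N.
Hypothesis eps_ge0 : 0 <= eps.
Hypothesis eps_le1 : eps <= 1.
Local Notation P := (srw R e).
Local Notation K := (lazy R e).
Local Notation n := #|V|.
Hypothesis eta_eps : d%:R * eta = eps.

Let d_gt0 : 0 < @GRing.natmul R 1 d. Proof. exact: (d_gt0 R simple_e conn_e reg_e card_gt2). Qed.
Let d_ge2 : 2 <= @GRing.natmul R 1 d.
Proof. by rewrite ler_nat (degree_gt1 simple_e conn_e reg_e card_gt2). Qed.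

Lemma lazy_ge0 x y : 0 <= K x y.
Proof. by rewrite divr_ge0// addr_ge0// ?ler0n//; apply: srw_ge0 reg_e _ _ => //. Qed.

Lemma lazy_sum x : \sum_y K x y = 1.
Proof.
have := lazyE e (fun=> 1 : R) x; rewrite /avg.
under eq_bigr => y _ do rewrite mulr1.
under [X in (_ + X)]eq_bigr => y _ do rewrite mulr1.
by rewrite (srw_sum R simple_e conn_e reg_e card_gt2) => ->; lra.
Qed.

Lemma lazy_sym x y : K x y = K y x.
Proof. by rewrite /lazy eq_sym (srw_sym R simple_e reg_e). Qed.

Lemma lazy_gt0 x y : 0 < K x y -> x = y \/ e x y.
Proof.
rewrite /lazy (srwE R reg_e); have [->|xy] := eqVneq x y; first by left.
by case: (e x y); [right | rewrite mul0r addr0 mul0r ltxx].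
Qed.

Lemma lazy_kap x y : 0 < K x y -> 1 <= 2 * d%:R * K x y.
Proof.
move=> Kxy; rewrite /lazy (srwE R reg_e).
have [xy|xy] := eqVneq x y.
  have h : 0 <= (e x y)%:R / d%:R :> R by rewrite divr_ge0// ?ler0n// ltW.
  move: d_ge2 h; rewrite /= mulr1n; set v := _ / d%:R; move: v (d%:R : R) => v u u2 v0; nra.
have [xy'|->] := lazy_gt0 Kxy; first by rewrite xy' eqxx in xy.
rewrite /= mulr1n mulr0n add0r mul1r.
have -> : 2 * d%:R * (d%:R^-1 / 2) = 1 :> R by field; rewrite gt_eqF.
exact: lexx.
Qed.

Lemma eta_bounds : [/\ 0 <= eta, eta < 1 & 2 * eta <= eps].
Proof.
have h0 : 0 <= eta by rewrite -(pmulr_rge0 _ d_gt0) eta_eps.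
have h2 : 2 * eta <= eps by rewrite -eta_eps ler_wpM2r.
by split => //; have := eps_le1; lra.
Qed.

(** Standing still is free for [f], so [f x U] is at most [1 + avg Q g x] for the
    lazy kernel.  For a biased one, with [A] the average of [g] over the
    neighbours, the required inequality is the combination of
    [g x <= 1 + A] and [g x <= 1 + A + 2 * eta * (B - A)] with weights
    [eta / 2] and [1 / 2]; the factor 2, due to laziness, explains the
    condition [2 * eta <= eps]. *)
Lemma subsolution_allowed f Q : subsolution e eps f -> allowed K eta Q ->
  forall x (U : {set V}), x \notin U -> U != finset.set0 ->
  f x U <= 1 + \sum_y Q x y * f y (U :\ y).
Proof.
move=> [f0 fstep] aQ x U xU U0.
pose g y := f y (U :\ y).
have gx : g x = f x U.
  rewrite /g; congr f; apply/setP => z; rewrite !inE.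
  by case: eqVneq => // ->; rewrite (negbTE xU).
rewrite -gx; set A := avg P g x.
have [h0 h1 h2] := eta_bounds.
have hb b : e x b -> g x <= 1 + (1 - eps) * A + eps * g b.
  by move=> xb; rewrite gx; exact: fstep.
have hA : g x <= 1 + A.
  have <- : \sum_b P x b * (1 + (1 - eps) * A + eps * g b) = 1 + A.
    under eq_bigr => b _ do rewrite mulrDr mulrCA.
    rewrite big_split /= -mulr_suml -mulr_sumr (srw_sum R simple_e conn_e reg_e card_gt2).
    rewrite -/(avg P g x) -/A; ring.
  rewrite -[leLHS]mul1r -[X in X * _ <= _](srw_sum R simple_e conn_e reg_e card_gt2 x) mulr_suml.
  apply: ler_sum => b _; rewrite (srwE R reg_e).
  case: (boolP (e x b)) => xb; last by rewrite !mul0r.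
  by apply: ler_wpM2l; [rewrite divr_ge0 | exact: hb].
rewrite -/(avg Q g x).
case: aQ => [->|[b Hb ->]]; first by rewrite lazyE -/A; lra.
rewrite biasedE lazyE -/A.
have [<-|xb] := lazy_gt0 (Hb x); first by nra.
have {}hb := hb _ xb.
set B := g (b x) in hb *.
have h3 : g x <= 1 + A + 2 * eta * (B - A).
  have [BA|BA] := leP A B; last by nra.
  have : 2 * eta * (B - A) >= 0 by rewrite mulr_ge0 ?subr_ge0// mulr_ge0.
  lra.
nra.
Qed.

Variable f : V -> {set V} -> R.
Hypothesis sub_f : subsolution e eps f.
Local Notation gap := (spectral_gap R e).
Hypothesis eps_gap : eps <= gap / 128.
Hypothesis n_large : 128 <= ln (@GRing.natmul R 1 n).

Variable C : R.
Hypothesis C_ge0 : 0 <= C.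
Hypothesis C_gap : C = 4000 / gap ^+ 2.

(** The cost of visiting one more vertex when [k] are left: boosting raises the
    density [k / n] of the target to the power [1 - eta / 2]. *)
Definition increment (k : nat) : R := C * (n%:R / k%:R) `^ (1 - eta / 2).

Definition budget (m : nat) : R := \sum_(k < m) increment k.+1.

Lemma increment_ge0 k : 0 <= increment k.
Proof. by rewrite /increment mulr_ge0 ?powR_ge0. Qed.

Lemma increment_le k l : (0 < k)%N -> (k <= l)%N -> increment l <= increment k.
Proof.
move=> k0 kl; rewrite /increment ler_wpM2l//.
have k0' : 0 < k%:R :> R by rewrite ltr0n.
have l0' : 0 < l%:R :> R by rewrite ltr0n (leq_trans k0).
have [h0 h1 _] := eta_bounds.
apply: ge0_ler_powR; rewrite ?nnegrE ?divr_ge0//; first by lra.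
by rewrite ler_wpM2l// lef_pV2 ?posrE// ler_nat.
Qed.

(** Concavity of [budget]; it allows one round, in which many new vertices may
    be found, to be analysed with a constant increment. *)
Lemma budget_tangent k m : (k <= m)%N ->
  budget k <= budget m - increment m * (m%:R - k%:R).
Proof.
move=> km; rewrite -(subnKC km); elim: (m - k)%N => [|j IH].
  by rewrite addn0 subrr mulr0 subr0.
have e1 : (k + j)%:R - k%:R = j%:R :> R by rewrite natrD addrAC subrr add0r.
have e2 : (k + j.+1)%:R - k%:R = j%:R + 1 :> R by rewrite natrD addrAC subrr add0r natr1.
rewrite e1 in IH; rewrite e2 addnS.
have -> : budget (k + j).+1 = budget (k + j) + increment (k + j).+1.
  by rewrite /budget big_ord_recr.
have h : increment (k + j).+1 * j%:R <= increment (k + j) * j%:R.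
  case: j {IH e1 e2} => [|j]; first by rewrite !mulr0.
  by rewrite ler_wpM2r// increment_le// addnS.
by rewrite (le_trans IH)// mulrDr mulr1; lra.
Qed.

(** Apply one round to a state that violates the bound most.  Its length is less
    than the decrease of [budget], because the expected number of visits
    exceeds the length times [1 + r], divided by [increment #|U|]. *)
Lemma subsolution_le_budget x (U : {set V}) : x \notin U -> f x U <= budget #|U|.
Proof.
have [gap0 gap2 contr] := spectral_gap_contraction R simple_e conn_e reg_e card_gt2.
have [h0 h1 h2] := eta_bounds.
have V0 : (0 < #|V|)%N by exact: leq_trans card_gt2.
move: x U; apply: maximum_principle => [||U c U0 c0 Hc x xU].
- exact: subsol0 sub_f.
- by rewrite /budget big_ord0.
have Upos : (0 < #|U|)%N by rewrite card_gt0.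
have [L [r [M [[L0 r0 HL] Hb HM Hret Hgain]]]] :=
  round_parameters gap0 gap2 eps_ge0 eps_gap h0 (ltW h1) n_large Upos (max_card U).
rewrite -C_gap in Hgain.
have alphaE : 1 + 2 * d%:R * eta = 1 + 2 * eps.
  by rewrite -mulrA eta_eps.
have kap0 : 0 <= 2 * d%:R :> R by rewrite mulr_ge0// ltW.
have [Qs [sQ aQ HQ]] := @exploration_round R V K (1 - gap / 2) eta (2 * d%:R)
  lazy_ge0 lazy_sum lazy_sym contr V0 h0 h1 kap0 lazy_kap U L r M Upos L0 r0 HL
  (ltac:(by rewrite alphaE)) HM.
set N := (M + _)%N in sQ Hret Hgain.
have tQ : all_kernels (tame K (1 + 2 * d%:R * eta)) Qs.
  by apply: sub_all_kernels aQ => Q; apply: tame_allowed => //; [exact: lazy_ge0|exact: lazy_sum|exact: lazy_kap].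
have stepQ : all_kernels (fun Q => forall x (U : {set V}), x \notin U -> U != finset.set0 ->
     f x U <= 1 + \sum_y Q x y * f y (U :\ y)) Qs.
  by apply: sub_all_kernels aQ => Q; exact: subsolution_allowed.
pose D := increment #|U|.
pose A := budget #|U| + c - D * #|U|%:R.
have D0 : 0 <= D by exact: increment_ge0.
have A0 : 0 <= A.
  have := budget_tangent (leq0n #|U|); rewrite /budget big_ord0 subr0 -/(budget _) -/D.
  by rewrite /A; lra.
have g5 : 0 <= 5 / gap by rewrite divr_ge0// ltW.
have all_drop (p : (V -> V -> R) -> Prop) k (Ts : seq (V -> V -> R)) : all_kernels p Ts -> all_kernels p (drop k Ts).
  by rewrite -{1}(cat_take_drop k Ts) => /all_kernels_cat[].
have ret k u : visits (drop k Qs) [set u] u <= 5 / gap.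
  have al1 : 1 <= 1 + 2 * d%:R * eta by rewrite lerDl mulr_ge0.
  have rho0 : 0 <= 1 - gap / 2 by lra.
  have ar : (1 + 2 * d%:R * eta) * (1 - gap / 2) <= 1 - gap / 4.
    have h3 : 0 <= eps * gap by rewrite mulr_ge0// ltW.
    by rewrite alphaE mulrDl mul1r; have := eps_gap; lra.
  have g4 : 0 < gap / 4 by lra.
  have := returns_le lazy_sum lazy_sym contr V0 u al1 rho0 ar g4 (all_drop _ k _ tQ).
  move=> /le_trans; apply; apply: le_trans Hret; rewrite lerD2l alphaE.
  rewrite size_drop sQ ler_wpM2r ?invr_ge0// ler_pM ?ler_nat ?leq_subr//.
    by rewrite exprn_ge0// -alphaE (le_trans ler01).
  by rewrite ler_weXn2l ?leq_subr// -alphaE.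
have fA y (W : {set V}) : y \notin W -> (#|W| <= #|U|)%N -> f y W <= A + D * #|W|%:R.
  move=> yW WU; rewrite (le_trans (Hc y W yW WU))//.
  by have := budget_tangent WU; rewrite -/D /A; lra.
have := round_bound A0 D0 g5 (subsol0 sub_f) tQ stepQ ret fA xU (leqnn _).
move=> /le_lt_trans; apply.
rewrite sQ; set v := visits Qs U x.
have -> : N%:R + A + D * #|U|%:R = N%:R + (budget #|U| + c) by rewrite /A; ring.
have r5 : 0 < 1 + 5 / gap by lra.
suff : N%:R < D / (1 + 5 / gap) * v by lra.
rewrite mulrAC ltr_pdivlMr//.
apply: lt_le_trans Hgain _; rewrite -/D.
by rewrite /D /increment ler_wpM2l ?increment_ge0// HQ.
Qed.

End Graph.

(** * Optimal cost and greedy strategy *)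

Section Value.
Context (R : realType) (V : finType) (e : rel V) (eps B : R).
Hypothesis P_ge0 : forall x y, 0 <= srw R e x y.
Hypothesis P_sum : forall x, \sum_y srw R e x y = 1.
Hypothesis eps_ge0 : 0 <= eps.
Hypothesis eps_le1 : eps <= 1.
Hypothesis has_nbr : forall x, exists y, e x y.
Local Notation P := (srw R e).
Implicit Types (f g : V -> {set V} -> R) (U : {set V}).

(** A default neighbour, over which to minimise. *)
Definition some_nbr (x : V) : V := odflt x [pick y | e x y].

Lemma some_nbrP x : e x (some_nbr x).
Proof.
rewrite /some_nbr; case: pickP => //= H.
by have [y] := has_nbr x; rewrite H.
Qed.

Definition best f U x : V := [arg min_(y < some_nbr x | e x y) f y U]%O.

Lemma best_edge f U x : e x (best f U x).
Proof.
by rewrite /best; case: Order.TotalTheory.arg_minP => //; exact: some_nbrP.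
Qed.

Lemma best_le f U x y : e x y -> f (best f U x) U <= f y U.
Proof.
rewrite /best; case: Order.TotalTheory.arg_minP; first exact: some_nbrP.
by move=> i _ H; exact: H.
Qed.

Definition bellman f U x : R :=
  1 + (1 - eps) * avg P (fun y => f y U) x + eps * f (best f U x) U.

Lemma bellman_le f g U x : (forall y, f y U <= g y U) -> bellman f U x <= bellman g U x.
Proof.
move=> fg; rewrite /bellman lerD//.
  by rewrite lerD2l ler_wpM2l ?subr_ge0// avg_le.
rewrite ler_wpM2l// (le_trans _ (fg _))// best_le//; exact: best_edge.
Qed.

(** Value iteration: the least expected cost over the first [k] steps.  The
    current vertex is removed from [U] on arrival. *)
Fixpoint value k x U : R :=
  if k is k'.+1 then
    if U :\ x == finset.set0 then 0 else bellman (value k') (U :\ x) x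
  else 0.

Lemma value_ge0 k x U : 0 <= value k x U.
Proof.
elim: k x U => //= k IH x U; case: ifP => // _.
rewrite /bellman !addr_ge0// ?mulr_ge0 ?subr_ge0//.
by apply: sumr_ge0 => y _; rewrite mulr_ge0.
Qed.

Lemma value_setD1 k x U : value k x (U :\ x) = value k x U.
Proof. by case: k => //= k; rewrite finset.setDDl finset.setUid. Qed.

Lemma value_monoS k x U : value k x U <= value k.+1 x U.
Proof.
elim: k x U => [|k IH] x U; first exact: (value_ge0 1).
rewrite /=; case: ifP => // _; apply: bellman_le => y; exact: IH.
Qed.

Lemma value_mono k l x U : (k <= l)%N -> value k x U <= value l x U.
Proof.
move=> /subnKC <-; elim: (l - k)%N => [|j IH]; first by rewrite addn0.
by rewrite addnS (le_trans IH)// value_monoS.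
Qed.

Lemma value_subsolution k : subsolution e eps (value k).
Proof.
split=> [x|x b U xU U0 xb]; first by case: k => //= k; rewrite finset.set0D eqxx.
have UE : U :\ x = U.
  by apply/setP => z; rewrite !inE; case: eqVneq => // ->; rewrite (negbTE xU).
rewrite (le_trans (value_monoS k x U))//= UE (negbTE U0) /bellman value_setD1.
have -> : avg P (fun y => value k y (U :\ y)) x = avg P (fun y => value k y U) x.
  by apply: eq_bigr => y _; rewrite value_setD1.
by rewrite lerD2l ler_wpM2l// best_le.
Qed.

Hypothesis value_le : forall k x U, value k x U <= B.

Definition optimal x U : R := sup (range (fun k => value k x U)).

Lemma has_sup_value x U : has_sup (range (fun k => value k x U)).
Proof.
split; first by exists (value 0 x U); exists 0%N.
by exists B => _ [k _ <-]; exact: value_le.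
Qed.

Lemma value_le_optimal k x U : value k x U <= optimal x U.
Proof. by apply: sup_upper_bound; [exact: has_sup_value | exists k]. Qed.

Lemma optimal_le x U : optimal x U <= B.
Proof.
apply: ge_sup; first by exists (value 0 x U); exists 0%N.
by move=> _ [k _ <-]; exact: value_le.
Qed.

Lemma optimal_ge0 x U : 0 <= optimal x U.
Proof. exact: (value_le_optimal 0). Qed.

(** By finiteness of the state space, the convergence to the supremum is
    uniform. *)
Lemma optimal_approx (delta : R) : 0 < delta ->
  exists k, forall x U, optimal x U - delta <= value k x U.
Proof.
move=> delta0.
have /choice[k Hk] : forall z : V * {set V}, exists k, optimal z.1 z.2 - delta <= value k z.1 z.2.
  move=> [x U]; have [_ [k _ <-] /ltW] := sup_adherent delta0 (has_sup_value x U).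
  by exists k.
exists (\max_z k z)%N => x U.
by rewrite (le_trans (Hk (x, U)))//= value_mono// (leq_bigmax (x, U)).
Qed.

(** Together with [value_subsolution] this says that [optimal] solves the
    optimality equation, so that the controller may follow it greedily. *)
Lemma optimal_supersolution x U : U :\ x != finset.set0 ->
  bellman optimal (U :\ x) x <= optimal x U.
Proof.
move=> U0; apply/ler_addgt0Pr => delta delta0.
have [k Hk] := optimal_approx delta0.
rewrite -lerBlDr (le_trans _ (value_le_optimal k.+1 x U))//= (negbTE U0).
set W := U :\ x; rewrite /bellman.
have h1 : avg P (fun y => optimal y W) x - delta <= avg P (fun y => value k y W) x.
  rewrite -[delta]mul1r -(P_sum x) /avg mulr_suml -sumrB.
  by apply: ler_sum => y _; rewrite -mulrBr ler_wpM2l.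
have h2 : optimal (best optimal W x) W - delta <= value k (best (value k) W x) W.
  rewrite (le_trans _ (Hk _ _))// lerD2r best_le//; exact: best_edge.
have : (1 - eps) * (avg P (fun y => optimal y W) x - delta) <=
    (1 - eps) * avg P (fun y => value k y W) x by rewrite ler_wpM2l// subr_ge0.
have : eps * (optimal (best optimal W x) W - delta) <=
    eps * value k (best (value k) W x) W by rewrite ler_wpM2l.
rewrite !mulrBr; lra.
Qed.

Definition greedy U x y : R := (1 - eps) * P x y + eps * (best optimal U x == y)%:R.

(** The probability that the greedy walk has not covered [U] after [j] steps; it
    depends on the history only through [x] and [U]. *)
Fixpoint uncovered_prob j x U : R :=
  if j is j'.+1 then \sum_y greedy (U :\ x) x y * uncovered_prob j' y (U :\ x)
  else (U :\ x != finset.set0)%:R.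

Lemma greedy_ge0 U x y : 0 <= greedy U x y.
Proof. by rewrite addr_ge0// mulr_ge0// subr_ge0. Qed.

Lemma uncovered_prob_ge0 j x U : 0 <= uncovered_prob j x U.
Proof.
elim: j x U => [|j IH] x U /=; first exact: ler0n.
by apply: sumr_ge0 => y _; rewrite mulr_ge0 ?greedy_ge0.
Qed.

(** The expected cover time is the sum over [j] of the probabilities of not
    being covered at time [j]; the verification argument bounds its partial
    sums. *)
Lemma uncovered_prob_sum k x U : \sum_(j < k) uncovered_prob j x U <= optimal x U.
Proof.
have uncovered_prob0 j : forall y (W : {set V}), W \subset [set y] -> uncovered_prob j y W = 0.
  elim: j => [|j IH] y W Wy /=.
    by rewrite finset.setD_eq0 Wy.
  apply: big1 => z _; rewrite IH ?mulr0//.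
  by move: Wy; rewrite -finset.setD_eq0 => /eqP ->; exact: finset.sub0set.
elim: k x U => [|k IH] x U; first by rewrite big_ord0 optimal_ge0.
have [U0|U0] := eqVneq (U :\ x) finset.set0.
  rewrite big1 ?optimal_ge0// => j _; apply: uncovered_prob0.
  by rewrite -finset.setD_eq0 U0.
apply: le_trans (optimal_supersolution U0).
rewrite big_ord_recl /= U0 /bellman -addrA lerD2l.
rewrite exchange_big /=.
apply: le_trans (_ : \sum_y greedy (U :\ x) x y * optimal y (U :\ x) <= _).
  apply: ler_sum => y _; rewrite -mulr_sumr ler_wpM2l ?greedy_ge0//; exact: IH.
rewrite /greedy; under eq_bigr => y _ do rewrite mulrDl -!mulrA.
rewrite big_split /= -!mulr_sumr lerD2l ler_wpM2l//.
rewrite (bigD1 (best optimal (U :\ x) x))//= eqxx mul1r big1 ?addr0//.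
by move=> y /negbTE; rewrite eq_sym => ->; rewrite mul0r.
Qed.

End Value.

(** * Construction of a process with given transition law *)

Section Process.
Local Open Scope classical_set_scope.
Local Open Scope ring_scope.
Context (R : realType) (V : finType) (v : V) (q : seq V -> V -> V -> R).
Hypothesis q_ge0 : forall h x y, 0 <= q h x y.
Hypothesis q_sum : forall h x, \sum_y q h x y = 1.
Implicit Types (g : seq V) (w : R).

(** Histories are kept in reverse order, the current vertex first. *)
Definition next_prob g y : R := q (rev (behead g)) (head v g) y.

Definition cumulative g (k : nat) : R := \sum_(i < #|V| | (i < k)%N) next_prob g (enum_val i).

Fixpoint weight g : R :=
  if g is y :: g' then
    if g' is [::] then (y == v)%:R else weight g' * next_prob g' y
  else 0.

Fixpoint slot_left g : R :=
  if g is y :: g' then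
    if g' is [::] then 0 else slot_left g' + weight g' * cumulative g' (enum_rank y)
  else 0.

(** Each history [g] is given a half-open interval whose length is its
    probability, and the interval of [g] is cut into those of its one-step
    extensions.  A uniform point of the unit interval then encodes an infinite
    trajectory: the one whose initial segments have intervals containing the
    point. *)
Definition slot g w : bool := (slot_left g <= w) && (w < slot_left g + weight g).

Lemma next_prob_ge0 g y : 0 <= next_prob g y. Proof. exact: q_ge0. Qed.

Lemma weight_ge0 g : 0 <= weight g.
Proof.
elim: g => //= y [|x g] IH; first exact: ler0n.
by rewrite mulr_ge0// next_prob_ge0.
Qed.

Lemma weight_cons y g : g != [::] -> weight (y :: g) = weight g * next_prob g y.
Proof. by case: g. Qed.

Lemma slot_left_cons y g : g != [::] -> slot_left (y :: g) = slot_left g + weight g * cumulative g (enum_rank y).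
Proof. by case: g. Qed.

Lemma cumulative0 g : cumulative g 0 = 0.
Proof. by rewrite /cumulative big_pred0. Qed.

Lemma cumulativeS g (i : 'I_#|V|) : cumulative g i.+1 = cumulative g i + next_prob g (enum_val i).
Proof.
rewrite /cumulative (bigD1 i)//= addrC; congr (_ + _); apply: eq_bigl => j.
by rewrite ltnS -val_eqE /= [RHS]ltn_neqAle andbC.
Qed.

Lemma cumulative_le g k l : (k <= l)%N -> cumulative g k <= cumulative g l.
Proof.
move=> kl; rewrite /cumulative big_mkcond [leRHS]big_mkcond; apply: ler_sum => i _.
case: (ltnP i k) => ik; first by rewrite (leq_trans ik kl).
by case: ifP => // _; exact: next_prob_ge0.
Qed.

Lemma cumulative_card g : cumulative g #|V| = 1.
Proof.
rewrite /cumulative -(q_sum (rev (behead g)) (head v g)) (eq_bigl predT); last first.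
  by move=> i; rewrite ltn_ord.
by rewrite -(big_enum_val _ (A := V)); apply: eq_bigl.
Qed.

Lemma cumulative_bounds g (i : 'I_#|V|) : 0 <= cumulative g i /\ cumulative g i + next_prob g (enum_val i) <= 1.
Proof.
split; first by rewrite -(cumulative0 g) cumulative_le.
by rewrite -cumulativeS -(cumulative_card g) cumulative_le.
Qed.

Lemma slot_parent y g w : g != [::] -> slot (y :: g) w -> slot g w.
Proof.
move=> g0; rewrite /slot slot_left_cons// weight_cons// => /andP[h1 h2].
have [c0 c1] := cumulative_bounds g (enum_rank y); rewrite enum_rankK in c1.
have w0 := weight_ge0 g; apply/andP; split.
  by apply: le_trans h1; rewrite lerDl mulr_ge0.
apply: lt_le_trans h2 _; rewrite -addrA lerD2l -mulrDr.
by rewrite -[leRHS]mulr1 ler_wpM2l.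
Qed.

Lemma slot_child g w : g != [::] -> slot g w -> exists y, slot (y :: g) w.
Proof.
move=> g0 /andP[h1 h2].
have w0 : 0 < weight g by rewrite -(ltrD2l (slot_left g)) addr0 (le_lt_trans h1).
have Hex : exists k, (k <= #|V|)%N && (w < slot_left g + weight g * cumulative g k).
  by exists #|V|; rewrite leqnn cumulative_card mulr1.
case: (ex_minnP Hex) => -[|k] /andP[kn hk] kmin.
  by move: hk; rewrite cumulative0 mulr0 addr0 ltNge h1.
exists (enum_val (Ordinal kn)); rewrite /slot slot_left_cons// weight_cons// enum_valK /=.
rewrite -addrA -mulrDr -(cumulativeS _ (Ordinal kn)) hk andbT leNgt.
by apply/negP => hk'; have := kmin k; rewrite (ltnW kn) hk' ltnn => /(_ isT).
Qed.

Lemma slot_inj y z g w : g != [::] -> slot (y :: g) w -> slot (z :: g) w -> y = z.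
Proof.
move=> g0; rewrite /slot !slot_left_cons// !weight_cons//.
have key (a b : V) : (enum_rank a < enum_rank b)%N ->
    slot_left g + weight g * cumulative g (enum_rank a) + weight g * next_prob g a <= slot_left g + weight g * cumulative g (enum_rank b).
  move=> ab; rewrite -addrA -mulrDr lerD2l ler_wpM2l ?weight_ge0//.
  by rewrite -{2}(enum_rankK a) -cumulativeS cumulative_le.
move=> /andP[y1 y2] /andP[z1 z2].
have [yz|zy|E] := ltngtP (enum_rank y) (enum_rank z).
- by have := lt_le_trans y2 (le_trans (key _ _ yz) z1); rewrite ltxx.
- by have := lt_le_trans z2 (le_trans (key _ _ zy) y1); rewrite ltxx.
- by apply/enum_rank_inj/val_inj.
Qed.

Definition next g w : V := odflt v [pick y | slot (y :: g) w].

Fixpoint traj t w : seq V := if t is t'.+1 then next (traj t' w) w :: traj t' w else [:: v].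

Definition walk t w : V := head v (traj t w).

Lemma size_traj t w : size (traj t w) = t.+1.
Proof. by elim: t => //= t ->. Qed.

Lemma traj_neq0 t w : traj t w != [::].
Proof. by rewrite -size_eq0 size_traj. Qed.

Lemma nextP g w : g != [::] -> slot g w -> slot (next g w :: g) w.
Proof.
move=> g0 gw; rewrite /next; case: pickP => //= H.
by have [y] := slot_child g0 gw; rewrite H.
Qed.

Lemma slot_traj t w : 0 <= w < 1 -> slot (traj t w) w.
Proof.
move=> w01; elim: t => [|t IH]; first by rewrite /slot /= eqxx add0r.
by apply: nextP => //; exact: traj_neq0.
Qed.

Lemma traj_slot t g w : size g = t.+1 -> slot g w -> traj t w = g.
Proof.
elim: t g => [|t IH] [//|y g] /= [sg].
  move: sg => /size0nil ->; rewrite /slot /= => /andP[w0]; rewrite add0r.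
  by case: eqP => [-> //|_]; rewrite ltNge w0.
have g0 : g != [::] by rewrite -size_eq0 sg.
move=> yg; have gw := slot_parent g0 yg.
rewrite (IH g)//; congr (_ :: _).
exact: (slot_inj g0 (nextP g0 gw) yg).
Qed.

Lemma slot01 g w : slot g w -> 0 <= w < 1.
Proof.
elim: g => [|y g IH]; first by rewrite /slot /= => /andP[]; rewrite addr0 => w0; rewrite ltNge w0.
have [->|g0 yg] := eqVneq g [::]; last by apply: IH; exact: slot_parent yg.
rewrite /slot /= add0r => /andP[-> w1]; rewrite (lt_le_trans w1)//.
by case: (_ == _).
Qed.

Lemma traj_mkseq t w : mkseq (walk^~ w) t.+1 = rev (traj t w).
Proof.
elim: t => [//|t IH].
by rewrite /mkseq -addn1 iotaD map_cat -/(mkseq _ _) IH /= add0n cats1 rev_cons.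
Qed.

Local Notation mR := (measurableTypeR R).

Lemma measurable_slot g : measurable [set w : mR | slot g w].
Proof.
rewrite (_ : [set w | _] = `[slot_left g, slot_left g + weight g[%classic); first exact: measurable_itv.
by apply/seteqP; split => w /=; rewrite in_itv.
Qed.

(** The default value of [next] is taken exactly outside the interval of [g], as
    that interval is covered by its subintervals. *)
Lemma measurable_next g y : g != [::] -> measurable [set w : mR | next g w = y].
Proof.
move=> g0; rewrite (_ : [set w | _] = [set w | slot (y :: g) w] `|`
   (if y == v then ~` [set w | slot g w] else set0)).
  apply: measurableU; first exact: measurable_slot.
  by case: ifP => // _; apply: measurableC; exact: measurable_slot.
apply/seteqP; split => w /=.
  have [gw|gw] := boolP (slot g w).
    by move=> <-; left; exact: nextP.
  have -> : next g w = v.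
    rewrite /next; case: pickP => //= z zg.
    by rewrite (slot_parent g0 zg) in gw.
  by move=> <-; right; rewrite eqxx; apply/negP.
case=> [yg|].
  by have gw := slot_parent g0 yg; exact: (slot_inj g0 (nextP g0 gw) yg).
case: eqP => // -> /= ngw; rewrite /next; case: pickP => //= z zg.
by case: ngw; exact: slot_parent zg.
Qed.

Lemma measurable_traj t g : measurable [set w : mR | traj t w = g].
Proof.
elim: t g => [|t IH] g /=.
  have [->|ne] := eqVneq g [:: v].
    by rewrite (_ : [set _ | _] = setT)//; apply/seteqP; split.
  rewrite (_ : [set _ | _] = set0)//; apply/seteqP; split => w //=.
  by move=> E; rewrite E eqxx in ne.
case: g => [|y g].
  by rewrite (_ : [set _ | _] = set0)//; apply/seteqP; split.
have [->|g0] := eqVneq g [::].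
  rewrite (_ : [set _ | _] = set0)//; apply/seteqP; split => w //= -[_ E].
  by have := traj_neq0 t w; rewrite E.
rewrite (_ : [set _ | _] = [set w | next g w = y] `&` [set w | traj t w = g]).
  by apply: measurableI => //; exact: measurable_next.
by apply/seteqP; split => w /= [] => [<- <-|<- ->].
Qed.

Lemma measurable_walk t y : measurable (walk t @^-1` [set y] : set mR).
Proof.
rewrite (_ : _ @^-1` _ = \bigcup_g
    (if head v g == y then [set w : mR | traj t w = g] else set0)).
  apply: countable_bigcupT_measurable => [|g]; first exact: countableP.
  by case: ifP => // _; exact: measurable_traj.
apply/seteqP; split => w /=.
  by move=> wy; exists (traj t w) => //; rewrite -[head _ _]/(walk t w) wy eqxx.
by case=> g _; case: eqP => //= <- <-.
Qed.

Definition walk_law : probability mR R := uniform_prob (@ltr01 R).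

Lemma walk_law_slot g : walk_law [set w | slot g w] = (weight g)%:E.
Proof.
rewrite /walk_law /= /uniform_prob.
rewrite (eq_integral (fun=> 1%E)); last first.
  move=> w; rewrite inE /= => gw; rewrite /uniform_pdf.
  by have /andP[w0 w1] := slot01 gw; rewrite w0 (ltW w1) /= subr0 invr1.
rewrite integral_cst ?mul1e; last exact: measurable_slot.
rewrite (_ : [set w | slot g w] = `[slot_left g, slot_left g + weight g[%classic); last first.
  by apply/seteqP; split => w /=; rewrite in_itv.
have := @lebesgue_measure_itv R `[slot_left g, slot_left g + weight g[.
rewrite /= lte_fin ltrDl => H; apply: (etrans H).
case: ifPn => [_|]; first by rewrite -EFinB addrAC subrr add0r.
by rewrite -leNgt => w0; congr (_%:E); apply/eqP; rewrite eq_le weight_ge0.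
Qed.

(** The trajectory [g] may also arise outside the unit interval, through the
    default values, but that has probability zero. *)
Lemma walk_law_traj t g : size g = t.+1 -> walk_law [set w | traj t w = g] = (weight g)%:E.
Proof.
move=> sg; rewrite -walk_law_slot.
pose A := [set w : mR | traj t w = g]; pose S := [set w : mR | slot g w].
have SA : S `<=` A by move=> w /=; exact: traj_slot.
rewrite -/A -/S; apply/eqP; rewrite eq_le.
rewrite [X in _ && X]le_measure ?inE//; [|exact: measurable_slot|exact: measurable_traj].
rewrite andbT.
pose I := `[0, 1[%classic : set mR.
have mI : measurable I by exact: measurable_itv.
have IC : walk_law (~` I) = 0%E.
  rewrite probability_setC//.
  have -> : I = [set w | slot [:: v] w].
    apply/seteqP; split => w; rewrite /I /= in_itv /= /slot /= eqxx add0r //.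
  by rewrite walk_law_slot /= eqxx subee.
have AI : A `&` I `<=` S.
  move=> w [Aw Iw]; rewrite /S /= -Aw; apply: slot_traj.
  by move: Iw; rewrite /I /= in_itv.
have mS : measurable S by exact: measurable_slot.
apply: le_trans (_ : walk_law (S `|` ~` I) <= _)%E.
  rewrite le_measure ?inE//; first exact: measurable_traj.
    by apply: measurableU => //; exact: measurableC.
  move=> w Aw; have [Iw|Iw] := pselect (I w); [left|by right].
  exact: AI.
have := @measureU2 _ _ R walk_law S (~` I) mS (measurableC mI).
by move=> /le_trans; apply; rewrite [X in (_ + X <= _)%E]IC adde0.
Qed.

Lemma mkseq_walkP s w : (0 < size s)%N ->
  mkseq (walk^~ w) (size s) = s <-> traj (size s).-1 w = rev s.
Proof.
move=> s0; rewrite -{1}(prednK s0) traj_mkseq; split => E; last by rewrite E revK.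
by apply: (can_inj (@revK _)); rewrite E revK.
Qed.

Lemma walk_law_mkseq s : (0 < size s)%N ->
  walk_law [set w | mkseq (walk^~ w) (size s) = s] = (weight (rev s))%:E.
Proof.
move=> s0; rewrite -(@walk_law_traj (size s).-1); last by rewrite size_rev prednK.
by congr (walk_law _); apply/seteqP; split => w /= /(mkseq_walkP w s0).
Qed.

End Process.

Section Existence.
Local Open Scope classical_set_scope.
Local Open Scope ring_scope.

Lemma exists_tbrw (R : realType) (V : finType) (e : rel V) (eps : R) (b : strategy R e) (v : V) :
  (forall x y, 0 <= srw R e x y) -> (forall x, \sum_y srw R e x y = 1) ->
  0 <= eps -> eps <= 1 ->
  exists (disp : measure_display) (Omega : measurableType disp)
    (P : probability Omega R) (X : nat -> Omega -> V), is_tbrw eps b v P X.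
Proof.
move=> P0 P1 e0 e1.
pose q h x y := (1 - eps) * srw R e x y + eps * b h x y.
have q0 h x y : 0 <= q h x y.
  by rewrite addr_ge0// mulr_ge0 ?subr_ge0//; exact: bias_ge0.
have q1 h x : \sum_y q h x y = 1.
  by rewrite big_split /= -!mulr_sumr P1 bias_sum; ring.
exists _, (measurableTypeR R), (walk_law R), (walk v q); split.
- by move=> t y; exact: measurable_walk.
- rewrite (_ : _ @^-1` _ = [set w | mkseq ((walk v q)^~ w) (size [:: v]) = [:: v]]).
    by rewrite walk_law_mkseq//= eqxx.
  by apply/seteqP; split => w.
- move=> h x y.
  have := @walk_law_mkseq R V v q q0 q1 (rcons (rcons h x) y).
  have := @walk_law_mkseq R V v q q0 q1 (rcons h x).
  rewrite !size_rcons => -> // -> //.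
  rewrite !rev_rcons -EFinM; congr (_%:E).
  by rewrite weight_cons// /next_prob /= revK.
Qed.

End Existence.

(** * Expected cover time of the greedy walk *)

Section Expectation.
Local Open Scope classical_set_scope.
Local Open Scope ring_scope.
Context (R : realType) (V : finType) (e : rel V) (eps : R) (b : strategy R e) (v : V).
Context (disp : measure_display) (Omega : measurableType disp) (P : probability Omega R).
Variable X : nat -> Omega -> V.
Hypothesis tbrwX : is_tbrw eps b v P X.

Definition uncovered (t : nat) : set Omega :=
  [set w | exists y, forall s, (s <= t)%N -> X s w <> y].

(** A cylinder event. *)
Definition follows_path (g : seq V) : set Omega := [set w | mkseq (X^~ w) (size g) = g].

Lemma measurable_at t y : measurable (X t @^-1` [set y]).
Proof. by have [] := tbrwX. Qed.

Lemma measurable_uncovered t : measurable (uncovered t).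
Proof.
rewrite (_ : uncovered t =
    \bigcup_y \bigcap_s (if (s <= t)%N then ~` (X s @^-1` [set y]) else setT)).
  apply: countable_bigcupT_measurable => [|y]; first exact: countableP.
  apply: bigcapT_measurable => s; case: ifP => // _.
  by apply: measurableC; exact: measurable_at.
apply/seteqP; split => w /=.
  move=> [y Hy]; exists y => // s _; case: ifP => // /Hy.
  exact.
move=> [y _ Hy]; exists y => s st; have := Hy s I; rewrite st; exact.
Qed.

Lemma measurable_follows_path g : measurable (follows_path g).
Proof.
rewrite (_ : follows_path g =
    \bigcap_s (if (s < size g)%N then X s @^-1` [set nth v g s] else setT)).
  by apply: bigcapT_measurable => s; case: ifP => // _; exact: measurable_at.
apply/seteqP; split => w /=.
  by move=> E s _; case: ifP => //= sg; rewrite -[in RHS]E nth_mkseq.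
move=> H; apply: (@eq_from_nth _ v); rewrite size_mkseq// => s sg.
by rewrite nth_mkseq//; have := H s I; rewrite sg.
Qed.

Lemma probability_split t (S : set Omega) : measurable S ->
  P S = (\sum_y P (S `&` X t @^-1` [set y]))%E.
Proof.
move=> mS; pose F (i : 'I_#|V|) := S `&` X t @^-1` [set enum_val i].
have SE : S = \big[setU/set0]_(i < #|V| | predT i) F i.
  rewrite -(@bigcup_pred _ _ predT); apply/seteqP; split => w.
    by move=> Sw; exists (enum_rank (X t w)) => //; split => //=; rewrite enum_rankK.
  by case=> i _ [].
rewrite [in LHS]SE measure_bigsetU_ord.
- pose G y := P (S `&` X t @^-1` [set y]).
  rewrite (eq_bigr (fun i : 'I_#|V| => G (enum_val i)))//.
  by rewrite -(big_enum_val _ (A := V)); apply: eq_bigl.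
- by move=> i; apply: measurableI => //; exact: measurable_at.
- move=> i k _ _ [w [[_ /= wi] [_ /= wk]]]; apply: enum_val_inj.
  by rewrite -wi -wk.
Qed.

Lemma follows_path_rcons g y w :
  follows_path (rcons g y) w <-> follows_path g w /\ X (size g) w = y.
Proof.
rewrite /follows_path /= size_rcons mkseqS.
by split=> [/rcons_inj[-> ->]|[-> ->]].
Qed.

Lemma uncovered_path g x w : follows_path (rcons g x) w ->
  uncovered (size g) w <-> exists y, y \notin rcons g x.
Proof.
rewrite /follows_path /= => E.
have memg y : (y \in rcons g x) = [exists s : 'I_(size g).+1, X s w == y].
  rewrite -E size_rcons; apply/mapP/existsP => [[s]|[s /eqP <-]].
    by rewrite mem_iota add0n => /andP[_ sg] ->; exists (Ordinal sg).
  by exists (s : nat) => //; rewrite mem_iota add0n ltn_ord.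
split=> -[y Hy]; exists y.
  rewrite memg; apply/existsPn => s; apply/eqP; apply: Hy.
  by rewrite -ltnS.
move=> s sg Xs; move: Hy; rewrite memg => /existsPn/(_ (Ordinal (sg : (s < (size g).+1)%N))).
by rewrite Xs eqxx.
Qed.

Hypothesis srw_ge0_e : forall x y, 0 <= srw R e x y.
Hypothesis eps_ge0 : 0 <= eps.
Hypothesis eps_le1 : eps <= 1.
Hypothesis greedyb : forall h x y, b h x y =
  (best e (optimal e eps) ((~: [set z in h])%SET :\ x) x == y)%:R.

(** Markov property of the pair formed by the current vertex and the set of
    unvisited vertices, conditionally on a history. *)
Lemma probability_uncovered j h x :
  P (follows_path (rcons h x) `&` uncovered (size h + j)) =
  (P (follows_path (rcons h x)) * (uncovered_prob e eps j x (~: [set z in h])%SET)%:E)%E.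
Proof.
have [_ _ chain] := tbrwX.
elim: j h x => [|j IH] h x.
  rewrite addn0 /=.
  have memU y : (y \in (~: [set z in h])%SET :\ x) = (y \notin rcons h x).
    by rewrite !inE mem_rcons in_cons negb_or.
  case: (altP eqP) => U0 /=.
    rewrite mule0 (_ : _ `&` _ = set0) ?measure0//.
    apply/seteqP; split => w //= [pw /(uncovered_path pw)[y]].
    by rewrite -memU U0 inE.
  rewrite mule1; congr (P _); apply/seteqP; split => w /=; first by case.
  move=> pw; split => //; apply/(uncovered_path pw).
  by have /set0Pn[y] := U0; rewrite memU => ?; exists y.
rewrite (probability_split (size h).+1); last first.
  by apply: measurableI; [exact: measurable_follows_path|exact: measurable_uncovered].
rewrite /= -sumEFin ge0_sume_distrr; last first.
  by move=> y _; rewrite lee_fin mulr_ge0 ?greedy_ge0// uncovered_prob_ge0.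
apply: eq_bigr => y _.
have -> : follows_path (rcons h x) `&` uncovered (size h + j.+1) `&` X (size h).+1 @^-1` [set y] =
   follows_path (rcons (rcons h x) y) `&` uncovered (size (rcons h x) + j).
  rewrite size_rcons addSnnS; apply/seteqP; split => w /=.
    by move=> [[pw uw] Xy]; split => //; apply/follows_path_rcons; rewrite size_rcons.
  by move=> [/follows_path_rcons[pw]]; rewrite size_rcons => Xy uw.
rewrite IH.
have -> : (~: [set z in rcons h x])%SET = (~: [set z in h])%SET :\ x.
  by apply/setP => z; rewrite !inE mem_rcons in_cons negb_or.
have := chain h x y.
rewrite /follows_path !size_rcons => ->.
rewrite -muleA; congr (_ * _)%E; rewrite -EFinM; congr (_ * _)%:E.
by rewrite greedyb.
Qed.

Lemma probability_uncovered0 j : P (uncovered j) = (uncovered_prob e eps j v [set: V]%SET)%:E.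
Proof.
have [_ start _] := tbrwX.
rewrite (@probability_split 0%N); last exact: measurable_uncovered.
rewrite (bigD1 v)//=.
rewrite [X in (_ + X)%E]big1 ?adde0 => [|y yv].
  have -> : uncovered j `&` X 0 @^-1` [set v] = follows_path [:: v] `&` uncovered (size (Nil V) + j).
    rewrite /= add0n setIC; congr (_ `&` _); apply/seteqP; split => w /=.
      by rewrite /follows_path /mkseq /= => ->.
    by case.
  have := probability_uncovered j [::] v; rewrite [rcons _ _]/= => ->.
  have -> : follows_path [:: v] = X 0 @^-1` [set v].
    by apply/seteqP; split => w /=; [case | rewrite /follows_path /mkseq /= => ->].
  rewrite start mul1e; congr (uncovered_prob _ _ _ _ _)%:E.
  by apply/setP => z; rewrite !inE.
apply/eqP; rewrite eq_le measure_ge0 andbT.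
have <- : P (~` (X 0%N @^-1` [set v])) = 0%E.
  by rewrite probability_setC ?start ?subee//; exact: measurable_at.
rewrite le_measure ?inE//.
- by apply: measurableI; [exact: measurable_uncovered | exact: measurable_at].
- by apply: measurableC; exact: measurable_at.
- by move=> w [_ /= wy] wv; rewrite -wy wv eqxx in yv.
Qed.

(** Tail formula: the cover time counts the times at which some vertex is
    missing.  As an equality it also yields measurability. *)
Lemma cover_time_series w :
  cover_time R (X^~ w) = (\sum_(0 <= j <oo) (\1_(uncovered j) w)%:E)%E.
Proof.
have ind0 j : (0 <= (\1_(uncovered j) w)%:E :> \bar R)%E by rewrite lee_fin.
have ind1 j : uncovered j w -> \1_(uncovered j) w = 1 :> R.
  by move=> /mem_set uj; rewrite indicE uj.
have sum_lt n : (forall j, (j < n)%N -> uncovered j w) ->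
    (\sum_(0 <= j < n) (\1_(uncovered j) w)%:E)%E = n%:R%:E :> \bar R.
  move=> un; rewrite sumEFin; congr (_%:E).
  rewrite big_mkord (eq_bigr (fun=> 1)) ?sumr_const ?card_ord//.
  by move=> j _; rewrite ind1//; exact: un.
apply/eqP; rewrite eq_le; apply/andP; split.
  have [[t Ht]|H] := pselect (exists t, ~ uncovered t w); last first.
    suff -> : (\sum_(0 <= j <oo) (\1_(uncovered j) w)%:E)%E = +oo%E :> \bar R by exact: leey.
    apply/eqyP => A A0; have un j : uncovered j w.
      by apply: contrapT => uj; apply: H; exists j.
    apply: le_trans (@nneseries_lim_ge R _ xpredT 0%N (Num.truncn A).+1 (fun n _ _ => ind0 n)).
    by rewrite sum_lt// lee_fin ltW// truncnS_gt.
  have Hex : exists t, `[< ~ uncovered t w >] by exists t; apply/asboolP.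
  case: (ex_minnP Hex) => {Ht}t /asboolP Ht tmin.
  apply: le_trans (@nneseries_lim_ge R _ xpredT 0%N t (fun n _ _ => ind0 n)).
  rewrite sum_lt => [|j jt].
    apply: ereal_inf_lbound; exists t => //= y.
    apply: contrapT => Hy; apply: Ht; exists y => s st Xs; apply: Hy.
    by exists s.
  by apply: contrapT => uj; have := tmin j; rewrite leqNgt jt => /(_ (asboolT uj)).
apply: le_ereal_inf_tmp => _ [t Ht <-].
apply: lime_le; first by apply: is_cvg_nneseries => n _ _; exact: ind0.
apply: nearW => n; rewrite sumEFin lee_fin.
have zero j : (t <= j)%N -> \1_(uncovered j) w = 0 :> R.
  move=> tj; rewrite indicE; case: (boolP (w \in uncovered j)) => // /set_mem[y Hy].
  by have [s st Xs] := Ht y; have := Hy s (leq_trans st tj).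
apply: le_trans (_ : \sum_(0 <= j < n) (j < t)%:R <= _).
  apply: ler_sum => j _; have [jt|jt] := ltnP j t; last by rewrite zero.
  by rewrite indicE; case: (_ \in _).
rewrite -natr_sum ler_nat; apply: (@leq_trans (minn n t)); last exact: geq_minr.
elim: n => [|n IH]; first by rewrite big_geq.
rewrite big_nat_recr// (leq_trans (leq_add IH (leqnn _)))//.
have [nt|tn] := ltnP n t.
  by rewrite addn1 leq_min leqnn.
by rewrite addn0 leq_min leqnn andbT ltnW.
Qed.

Lemma expected_cover_le (B : R) :
  (forall k, \sum_(j < k) uncovered_prob e eps j v [set: V]%SET <= B) ->
  (\int[P]_w cover_time R (X^~ w) <= B%:E)%E.
Proof.
move=> HB.
rewrite (eq_integral (fun w => \sum_(0 <= j <oo) (\1_(uncovered j) w)%:E)%E); last first.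
  by move=> w _; exact: cover_time_series.
rewrite integral_nneseries//; last first.
  by move=> j; apply/measurable_EFinP; apply: measurable_indic; exact: measurable_uncovered.
apply: lime_le.
  by apply: is_cvg_nneseries => n _ _; exact: integral_ge0.
apply: nearW => n.
have int_ind j : (\int[P]_w (\1_(uncovered j) w)%:E)%E =
    (uncovered_prob e eps j v [set: V]%SET)%:E.
  rewrite integral_indic //; [by rewrite setIT; exact: probability_uncovered0 | exact: measurable_uncovered].
rewrite (eq_bigr _ (fun j _ => int_ind j)).
by rewrite sumEFin lee_fin big_mkord.
Qed.

End Expectation.

(** * The bound on the cover time *)

Section Main.
Context (R : realType) (V : finType) (e : rel V) (d : nat) (eps : R).
Hypothesis simple_e : simple_graph e.
Hypothesis conn_e : connected_graph e.
Hypothesis reg_e : regular_graph e d.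
Hypothesis n_large : 128 <= ln (@GRing.natmul R 1 #|V|).
Hypothesis card_gt2 : (2 < #|V|)%N.
Hypothesis eps_ge0 : 0 <= eps.
Local Notation gap := (spectral_gap R e).
Hypothesis eps_gap : eps <= gap / 128.
Local Notation n := #|V|.

Let gap_facts := spectral_gap_contraction R simple_e conn_e reg_e card_gt2.

Lemma eps_le1 : eps <= 1.
Proof. by have [_ ? _] := gap_facts; have := eps_gap; lra. Qed.

Lemma has_neighbour x : exists y, e x y.
Proof.
have : (0 < degree e x)%N.
  by rewrite reg_e (ltn_trans _ (degree_gt1 simple_e conn_e reg_e card_gt2)).
by move=> /card_gt0P[y]; rewrite inE; exists y.
Qed.

Definition greedy_bias (h : seq V) (x y : V) : R :=
  (best e (optimal e eps) ((~: [set z in h])%SET :\ x) x == y)%:R.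

Lemma greedy_bias_ge0 h x y : 0 <= greedy_bias h x y.
Proof. exact: ler0n. Qed.

Lemma greedy_bias_sum h x : \sum_y greedy_bias h x y = 1.
Proof.
rewrite /greedy_bias; set z := best _ _ _ _.
rewrite (bigD1 z)//= eqxx big1 ?addr0// => y /negbTE.
by rewrite eq_sym => ->.
Qed.

Lemma greedy_bias_supp h x y : ~~ e x y -> greedy_bias h x y = 0.
Proof.
move=> xy; rewrite /greedy_bias; case: eqP => // E.
by have := best_edge has_neighbour (optimal e eps) ((~: [set z in h])%SET :\ x) x; rewrite E (negbTE xy).
Qed.

Definition greedy_strategy : strategy R e :=
  Strategy greedy_bias_ge0 greedy_bias_sum greedy_bias_supp.

(** A bound on the finite-horizon costs suffices: the optimal cost then is
    finite, and the greedy strategy realises it. *)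
Lemma tb_cover_from_le (B : R) v :
  (forall k x (U : {set V}), value e eps k x U <= B) -> (tb_cover_from e eps v <= B%:E)%E.
Proof.
move=> HB.
have P0 := srw_ge0 R reg_e.
have P1 := srw_sum R simple_e conn_e reg_e card_gt2.
have [dis [Om [Pr [X tbrwX]]]] := exists_tbrw greedy_strategy v P0 P1 eps_ge0 eps_le1.
apply: ereal_inf_le; exists (\int[Pr]_w cover_time R (X^~ w))%E.
  by exists greedy_strategy, dis, Om, Pr, X.
apply: (expected_cover_le tbrwX) => //; first exact: eps_le1.
move=> k; apply: le_trans (optimal_le HB v [set: V]%SET).
by apply: (uncovered_prob_sum (B := B)) => //; [exact: eps_le1 | exact: has_neighbour].
Qed.

Lemma cover_bounds : exists B : R,
  [/\ forall k x (U : {set V}), value e eps k x U <= B,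
      B <= 10 ^+ 10 * d%:R `^ (100 / gap) * n%:R * ln n%:R &
      0 < eps -> B <= 10 ^+ 10 * d%:R `^ (100 / gap) * n%:R / eps].
Proof.
have [gap0 gap2 _] := gap_facts.
have d1 := degree_gt1 simple_e conn_e reg_e card_gt2.
have d0 : 0 < d%:R :> R by rewrite ltr0n (ltn_trans _ d1).
have n0 : (0 < n)%N by exact: leq_trans card_gt2.
have N0 : 0 < n%:R :> R by rewrite ltr0n.
pose eta := eps / d%:R.
have eta_eps : d%:R * eta = eps by rewrite mulrC divfK// gt_eqF.
have [eta0 eta1 _] := eta_bounds simple_e conn_e reg_e card_gt2 eps_ge0 eps_le1 eta_eps.
have [C [C0 C_gap]] : exists C : R, 0 <= C /\ C = 4000 / gap ^+ 2.
  exists (4000 / gap ^+ 2); split; last by [].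
  by apply: mulr_ge0; [exact: ler0n | rewrite invr_ge0 sqr_ge0].
pose F := @budget R V eta C.
have F_mono k l : (k <= l)%N -> F k <= F l.
  move=> /subnKC <-; elim: (l - k)%N => [|j IH]; first by rewrite addn0.
  rewrite addnS (le_trans IH)// /F /budget [leRHS]big_ord_recr lerDl.
  exact: increment_ge0.
have big_const : 4 * C * d%:R <= 10 ^+ 10 * d%:R `^ (100 / gap).
  have -> : 4 * C * d%:R = 16000 * d%:R / gap ^+ 2 by rewrite C_gap; field; rewrite gt_eqF.
  exact: final_constant.
move: big_const; set T := 10 ^+ 10 * _; move: T => T HT.
have FE : F n = C * \sum_(k < n) (n%:R / k.+1%:R) `^ (1 - eta / 2).
  by rewrite mulr_sumr.
exists (F n); split.
- move=> k x U; rewrite -value_setD1.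
  apply: le_trans (_ : F #|U :\ x| <= _); last by apply: F_mono; exact: max_card.
  apply: (subsolution_le_budget simple_e conn_e reg_e card_gt2 eps_ge0 eps_le1 eta_eps) => //.
    apply: value_subsolution => //; [exact: (srw_ge0 R reg_e)|exact: eps_le1|exact: has_neighbour].
  by rewrite !inE eqxx.
- rewrite FE; apply: le_trans (_ : C * (n%:R * (1 + ln n%:R)) <= _).
    by rewrite ler_wpM2l// powR_sum_le_ln//; lra.
  have CT : 2 * C <= T.
    apply: le_trans HT; have d2 : 2 <= d%:R :> R by rewrite ler_nat.
    nra.
  have L := n_large.
  apply: le_trans (_ : 2 * C * (n%:R * ln n%:R) <= _); last first.
    by rewrite -[leRHS]mulrA ler_wpM2r// mulr_ge0//; lra.
  have : n%:R * (1 + ln n%:R) <= n%:R * (2 * ln n%:R) :> R by rewrite ler_wpM2l//; lra.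
  move=> /(ler_wpM2l C0) /le_trans; apply; rewrite le_eqVlt; apply/orP; left; apply/eqP; ring.
- move=> eps0; have e0 : 0 < eta by rewrite divr_gt0.
  rewrite FE; apply: le_trans (_ : C * (n%:R / (eta / 2)) <= _).
    by rewrite ler_wpM2l// powR_sum_le_inv//; lra.
  have -> : C * (n%:R / (eta / 2)) = 2 * C * d%:R * n%:R / eps.
    by rewrite /eta; field; rewrite !gt_eqF.
  rewrite ler_wpM2r ?invr_ge0// ler_wpM2r// (le_trans _ HT)//.
  rewrite ler_wpM2r ?(ltW d0)// ler_wpM2r//; lra.
Qed.

Lemma tb_cover_le : (tb_cover e eps <=
  (10 ^+ 10 * (d%:R `^ (100 / gap)) * n%:R)%:E * mine (eps%:E)^-1 (ln n%:R)%:E)%E.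
Proof.
have [B [HB Bln Beps]] := cover_bounds.
have T0 : 0 < 10 ^+ 10 * (d%:R `^ (100 / gap)) * n%:R :> R.
  have d1 := degree_gt1 simple_e conn_e reg_e card_gt2.
  rewrite !mulr_gt0// ?ltr0n ?(leq_trans _ card_gt2)//.
  by rewrite powR_gt0// ltr0n (ltn_trans _ d1).
move: T0 Bln Beps; set T := 10 ^+ 10 * _ * _; move: T => T T0 Bln Beps.
rewrite /tb_cover; elim/big_ind: _ => [||v _].
- exact: leNye.
- by move=> x y xT yT; rewrite ge_max xT.
apply: le_trans (tb_cover_from_le v HB) _.
rewrite /mine; case: ifP => _; last by rewrite -EFinM lee_fin.
rewrite inver; case: ifPn => [_|eps0]; first by rewrite gt0_muley ?lte_fin// leey.
by rewrite -EFinM lee_fin Beps// lt_neqAle eq_sym eps0 eps_ge0.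
Qed.

End Main.

(* In \bar R the inverse of 0 is +oo, so (eps%:E)^-1 is +oo for eps = 0. *)
Theorem theorem1p3 :
  exists n0 : nat,
  forall (R : realType) (V : finType) (e : rel V) (d n : nat) (eps : R),
    simple_graph e -> connected_graph e -> regular_graph e d ->
    #|V| = n -> (n0 <= n)%N ->
    0 <= eps -> eps <= spectral_gap R e / 128 ->
    (tb_cover e eps <=
       (10 ^+ 10 * (d%:R `^ (100 / spectral_gap R e)) * n%:R)%:E *
       mine (eps%:E)^-1 (ln n%:R)%:E)%E.
Proof.
suff H k (R : realType) (V : finType) (e : rel V) (d n : nat) (eps : R) : (256 <= k)%N ->
    simple_graph e -> connected_graph e -> regular_graph e d ->
    #|V| = n -> (2 ^ k <= n)%N ->
    0 <= eps -> eps <= spectral_gap R e / 128 ->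
    (tb_cover e eps <=
       (10 ^+ 10 * (d%:R `^ (100 / spectral_gap R e)) * n%:R)%:E *
       mine (eps%:E)^-1 (ln n%:R)%:E)%E.
  (* [2 ^ 256] vertices ensure [128 <= ln n], as required for one round. *)
  by exists (2 ^ 256)%N => R V e d n eps; apply: H; exact: leqnn.
move=> k256 simple_e conn_e reg_e <- kn eps0 eps_gap.
have n_large : 128 <= ln (#|V|%:R : R).
  apply: le_trans (ln_ge_half _ kn).
  rewrite ler_pdivlMr// (_ : 128 * 2 = 256%:R :> R); last by lra.
  by rewrite ler_nat.
have card_gt2 : (2 < #|V|)%N.
  by rewrite (leq_trans _ kn)// (leq_trans _ (leq_pexp2l _ (leq_trans _ k256 : (2 <= k)%N))).
exact: tb_cover_le.
Qed.
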